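(* A function $\chi: S(2^\infty)\to\mathbb{C}$ is an indecomposable character if and only if there exists $\alpha\in\mathbb{Z}_+\cup\{\infty\}$ (where $\mathbb{Z}_+=\{0,1,2,\dots\}$) such that $\chi(s)=\mu(Fix(s))^\alpha$ for all $s\in S(2^\infty)$.
   Context: Let $X=\prod_{1}^\infty\{0,1\}$ be the space of infinite $0,1$-sequences, and $\mu=\nu^{\otimes\infty}$ the product measure on $X$ with $\nu(\{0\})=\nu(\{1\})=1/2$. Let $X_n$ be the set of $0,1$-sequences of length $n$, and $S(2^n)$ the group of all bijections $X_n\to X_n$. $S(2^n)$ acts on $X$ by $s((x,a))=(s(x),a)$ for $x\in X_n$, $a\in X$; via this action $S(2^n)$ is a subgroup of $S(2^{n+1})$, and $S(2^\infty)=\bigcup_{n} S(2^n)$. For a bijection $s$ of $X$, $Fix(s)=\{x\in X: s(x)=x\}$. A character on a group $G$ is a function $\chi:G\to\mathbb{C}$ with $\chi(g_1g_2)=\chi(g_2g_1)$ for all $g_1,g_2$, such that the matrix $(\chi(g_ig_j^{-1}))_{i,j=1}^n$ is positive semidefinite for all $n$ and $g_1,\dots,g_n\in G$, and $\chi(e)=1$. A character is indecomposable if it cannot be written as $\alpha\chi_1+(1-\alpha)\chi_2$ with $0<\alpha<1$ and $\chi_1\neq\chi_2$ characters. Conventions: $0^0=1$, $x^\infty=0$ for $x\in[0,1)$, and $1^\infty=1$. *)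

(* Defs.v *)
From HB Require Import structures.
From mathcomp Require Import all_boot all_order all_algebra all_fingroup.
From mathcomp Require Import reals complex.
Set Implicit Arguments. Unset Strict Implicit. Unset Printing Implicit Defensive.
Import Order.TTheory GRing.Theory Num.Theory.
Local Open Scope ring_scope.
Local Open Scope complex_scope.

(* X = infinite 0/1 sequences, encoded as nat -> bool (coordinate i = (i+1)-th term). *)
Definition X := nat -> bool.

Record S2elt := MkS2 { lvl : nat; sperm : {perm (lvl.-tuple bool)} }.

Definition prefix (n : nat) (x : X) : n.-tuple bool := [tuple x i | i < n].

(* Action of s in S(2^n) on X: s((y, a)) = (s(y), a). *)
Definition s2act (s : S2elt) : X -> X :=
  fun x i => nth (x i) (sperm s (prefix (lvl s) x)) i.

(* S(2^\infty) = union of the S(2^n), realised as the bijections s2act s of X. *)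
Definition inS2inf (f : X -> X) : Prop := exists s : S2elt, f = s2act s.

Definition s2inv (s : S2elt) : S2elt := MkS2 (sperm s)^-1.

Definition Fix (f : X -> X) : X -> Prop := fun x => f x = x.

(* For s in S(2^n), Fix(s2act s) is the cylinder set over the base
   FixBase s = {y in X_n | s y = y}.  The Bernoulli(1/2) product measure mu of a
   cylinder set over B subset X_n is #|B| / 2^n. *)
Definition FixBase (s : S2elt) : {set (lvl s).-tuple bool} :=
  [set y | sperm s y == y].
Definition mu_cyl {R : realType} (n : nat) (B : {set n.-tuple bool}) : R :=
  #|B|%:R / 2%:R ^+ n.
Definition muFix {R : realType} (s : S2elt) : R := mu_cyl (FixBase s).

(* alpha in Z_+ \cup {oo}, encoded as option nat (None = oo);
   x^oo = 0 for x in [0,1), 1^oo = 1, and x^0 = 1 (incl. 0^0 = 1). *)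
Definition powinf {R : realType} (x : R) (a : option nat) : R :=
  match a with
  | Some k => x ^+ k
  | None => if x == 1 then 1 else 0
  end.

(* Characters on S(2^\infty), as functions on bijections of X (only the values
   on elements s2act s matter). Group law = composition, unit = identity. *)
Definition is_character {R : realType} (chi : (X -> X) -> R[i]) : Prop :=
  [/\ (forall g h : S2elt, chi (s2act g \o s2act h) = chi (s2act h \o s2act g)),
      (forall (n : nat) (g : 'I_n -> S2elt) (c : 'I_n -> R[i]),
          0 <= \sum_(i < n) \sum_(j < n)
                 (c i)^* * c j * chi (s2act (g i) \o s2act (s2inv (g j))))
    & chi (fun x => x) = 1].

Definition is_indecomposable_character {R : realType} (chi : (X -> X) -> R[i]) : Prop :=
  is_character chi /\
  ~ (exists (a : R) (chi1 chi2 : (X -> X) -> R[i]),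
       [/\ 0 < a < 1, is_character chi1, is_character chi2,
           (forall g : S2elt, chi (s2act g) = a%:C * chi1 (s2act g) + (1 - a)%:C * chi2 (s2act g))
         & exists g : S2elt, chi1 (s2act g) <> chi2 (s2act g)]).

(* Main.v *)
Require Import Defs.
From HB Require Import structures.
From mathcomp Require Import all_boot all_order all_algebra all_fingroup.
From mathcomp Require Import boolp reals complex.
From mathcomp Require Import ring lra zify.
Set Implicit Arguments. Unset Strict Implicit. Unset Printing Implicit Defensive.
Import Order.TTheory GRing.Theory Num.Theory.
Local Open Scope ring_scope.

(* Write e_g for the vector attached to g in the GNS space of a character chi, so that
   <e_g, e_h> = chi(g h^-1).  Everything rests on families of M such vectors whose pairwise
   inner products are constant: by Cauchy-Schwarz their averages converge as M -> oo.

   1. chi(s) depends only on mu(Fix s).  For involutions this is conjugacy.  If s has support A,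
   its conjugates by suitable fibrewise translations have quotients that are involutions with
   support A, so their average has the same limit as the average of translations over A.

   2. Let F(y) be the value of chi on elements with mu(Fix) = y.  Testing positivity on signed
   sums over {0,1}^j shows that all differences of F at 0 are nonnegative.

   3. If h is an involution in independent coordinates, (chi(s) +- chi(s h)) / (1 +- chi(h)) are
   characters; so indecomposability forces F(y y') = F(y) F(y').  Being multiplicative with
   nonnegative differences, F is either the indicator of y = 1 or, up to scaling, a polynomial
   P on the integers with P(2x) = P(2) P(x), hence a monomial.

   4. Conversely |chi(s)|^2 <= chi(s x s^-1) for any character, by taking copies of s in
   independent coordinates; if mu(Fix)^alpha = a chi1 + (1-a) chi2, for which equality holds,
   strict convexity of |.|^2 gives chi1 = chi2. *)

(** * Permutations acting on sequences, and characters as families *)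

Local Notation prefix := Defs.prefix.

Definition pow2 (T : finType) : Prop := exists n, #|T| = (2 ^ n)%N.

Lemma pow2_tuple n : pow2 (n.-tuple bool).
Proof. by exists n; rewrite card_tuple card_bool. Qed.

Lemma pow2_prod (T U : finType) : pow2 T -> pow2 U -> pow2 (T * U)%type.
Proof. by move=> [n hn] [m hm]; exists (n + m)%N; rewrite card_prod hn hm expnD. Qed.

Lemma pow2_ffun (I T : finType) : pow2 T -> pow2 {ffun I -> T}.
Proof. by move=> [n hn]; exists (n * #|I|)%N; rewrite card_ffun hn expnM. Qed.

Lemma pow2_bool : pow2 bool.
Proof. by exists 1%N; rewrite card_bool. Qed.

Lemma pow2_unit : pow2 unit.
Proof. by exists 0%N; rewrite card_unit. Qed.

Lemma pow2_gt0 (T : finType) : pow2 T -> (0 < #|T|)%N.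
Proof. by move=> [n ->]; rewrite expn_gt0. Qed.

Lemma eq_card_bij (T U : finType) : #|T| = #|U| -> exists f : T -> U, bijective f.
Proof.
move=> E; exists (fun x => enum_val (cast_ord E (enum_rank x))).
exists (fun y => enum_val (cast_ord (esym E) (enum_rank y))) => x.
  by rewrite enum_valK cast_ordK enum_rankK.
by rewrite enum_valK cast_ordKV enum_rankK.
Qed.

(* Junk value [1] when [f] is not injective. *)
Definition pfun (T : finType) (f : T -> T) : {perm T} := insubd (1%g : {perm T}) (finfun f).

Lemma pfunE (T : finType) (f : T -> T) : injective f -> pfun f =1 f.
Proof.
move=> fI x; rewrite /pfun.
have H : injectiveb (finfun f).
  by apply/injectiveP => y z; rewrite !ffunE; apply: fI.
by rewrite -pvalE -[pval _]/(val _) insubdK // ffunE.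
Qed.

Section Action.

Variable n : nat.
Implicit Types (p q : {perm n.-tuple bool}) (x : X).

Lemma prefix_s2act p x : prefix n (s2act (MkS2 p) x) = p (prefix n x).
Proof.
apply: eq_from_tnth => i; rewrite tnth_mktuple /s2act /=.
by rewrite (tnth_nth (x i)).
Qed.

Lemma s2act_tail p x i : (n <= i)%N -> s2act (MkS2 p) x i = x i.
Proof. by move=> le_ni; rewrite /s2act /= nth_default // size_tuple. Qed.

Lemma eq_X x y : prefix n x = prefix n y -> (forall i, (n <= i)%N -> x i = y i) -> x = y.
Proof.
move=> Hp Ht; apply: funext => i; case: (ltnP i n) => Hi; last exact: Ht.
by move: (congr1 (fun t => tnth t (Ordinal Hi)) Hp); rewrite !tnth_mktuple.
Qed.

Lemma s2act_comp p q : s2act (MkS2 p) \o s2act (MkS2 q) = s2act (MkS2 (q * p)%g).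
Proof.
apply: funext => x; apply: eq_X => [|i Hi]; first by rewrite /= !prefix_s2act permM.
by rewrite /= !s2act_tail.
Qed.

Lemma s2act1 : s2act (MkS2 (1%g : {perm n.-tuple bool})) = id.
Proof.
apply: funext => x; apply: eq_X => [|i Hi]; first by rewrite prefix_s2act perm1.
by rewrite s2act_tail.
Qed.

Lemma prefix_surj (t : n.-tuple bool) : exists x, prefix n x = t.
Proof.
exists (fun i => nth false t i); apply: eq_from_tnth => i.
by rewrite tnth_mktuple (tnth_nth false).
Qed.

Lemma s2act_inj p q : s2act (MkS2 p) = s2act (MkS2 q) -> p = q.
Proof.
move=> E; apply/permP => t; have [x <-] := prefix_surj t.
by rewrite -!prefix_s2act E.
Qed.

Variable m : nat.

Definition tfst (y : (n + m).-tuple bool) : n.-tuple bool := [tuple tnth y (lshift m i) | i < n].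
Definition tsnd (y : (n + m).-tuple bool) : m.-tuple bool := [tuple tnth y (rshift n i) | i < m].

Lemma tfst_cat (t : n.-tuple bool) (u : m.-tuple bool) : tfst [tuple of t ++ u] = t.
Proof. by apply: eq_from_tnth => i; rewrite tnth_mktuple tnth_lshift. Qed.

Lemma tsnd_cat (t : n.-tuple bool) (u : m.-tuple bool) : tsnd [tuple of t ++ u] = u.
Proof. by apply: eq_from_tnth => i; rewrite tnth_mktuple tnth_rshift. Qed.

Lemma tcat_split y : [tuple of tfst y ++ tsnd y] = y.
Proof.
apply: eq_from_tnth => i; rewrite -(splitK i); case: (fintype.split i) => j /=.
  by rewrite tnth_lshift tnth_mktuple.
by rewrite tnth_rshift tnth_mktuple.
Qed.

Lemma tsplit_inj : injective (fun y => (tfst y, tsnd y)).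
Proof. move=> y z E; rewrite -(tcat_split y) -(tcat_split z).
by rewrite (congr1 fst E : tfst y = tfst z) (congr1 snd E : tsnd y = tsnd z). Qed.

Definition up_perm p : {perm (n + m).-tuple bool} :=
  pfun (fun y => [tuple of p (tfst y) ++ tsnd y]).

Lemma up_permE p y : up_perm p y = [tuple of p (tfst y) ++ tsnd y].
Proof.
rewrite pfunE // => a b E; apply: tsplit_inj; congr (_, _).
  by apply: (@perm_inj _ p); rewrite -(tfst_cat (p (tfst a)) (tsnd a)) E tfst_cat.
by rewrite -(tsnd_cat (p (tfst a)) (tsnd a)) E tsnd_cat.
Qed.

Lemma tfst_up p y : tfst (up_perm p y) = p (tfst y).
Proof. by rewrite up_permE tfst_cat. Qed.

Lemma tsnd_up p y : tsnd (up_perm p y) = tsnd y.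
Proof. by rewrite up_permE tsnd_cat. Qed.

Lemma up_permV p : up_perm p^-1 = (up_perm p)^-1%g.
Proof.
apply/permP => y; apply: (@perm_inj _ (up_perm p)); rewrite permKV.
by apply: tsplit_inj; rewrite !tfst_up !tsnd_up permKV.
Qed.

Lemma tfst_prefix x : tfst (prefix (n + m) x) = prefix n x.
Proof. by apply: eq_from_tnth => i; rewrite !tnth_mktuple. Qed.

End Action.

Lemma s2act_up n m (p : {perm n.-tuple bool}) : s2act (MkS2 (up_perm m p)) = s2act (MkS2 p).
Proof.
apply: funext => x; apply: (@eq_X n) => [|i Hi].
  rewrite -(@tfst_prefix n m) [in LHS]prefix_s2act tfst_up tfst_prefix.
  by rewrite -prefix_s2act.
rewrite [RHS]s2act_tail //; case: (ltnP i (n + m)) => Him; last exact: s2act_tail.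
transitivity (nth (x i) (tsnd (prefix (n + m) x)) (i - n)).
  by rewrite /s2act up_permE nth_cat size_tuple ltnNge Hi.
have Hj : (i - n < m)%N by lia.
rewrite -[(i - n)%N]/(nat_of_ord (Ordinal Hj)) -tnth_nth !tnth_mktuple /=.
by rewrite subnKC.
Qed.

Lemma s2_lift (s : S2elt) N : (lvl s <= N)%N -> exists q : {perm N.-tuple bool},
  s2act s = s2act (MkS2 q) /\ s2act (s2inv s) = s2act (MkS2 q^-1%g).
Proof.
case: s => n p /= Hn; rewrite -(subnKC Hn); exists (up_perm (N - n) p).
by rewrite -up_permV !s2act_up.
Qed.

(** * Characters as functions on permutations of finite sets of size a power of 2 *)

Section Families.

Variable R : realType.
Local Notation C := R[i].
Local Notation family := (forall T : finType, {perm T} -> C).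

(* A character of S(2^oo), seen as a function on the permutations of all finite sets of
   cardinality a power of 2: [fam_cov] says that only the isomorphism class of [p] matters,
   and that [p] and its extension [p x id] to [T x W] have the same value. *)
Record charfam (V : family) : Prop := CharFam {
  fam_cov : forall (T T' W : finType) (f : T' -> T) (r : T' -> W)
      (p : {perm T}) (p' : {perm T'}),
    pow2 T -> pow2 W -> #|T'| = (#|T| * #|W|)%N -> injective (fun y => (f y, r y)) ->
    (forall y, f (p' y) = p (f y)) -> (forall y, r (p' y) = r y) ->
    V T' p' = V T p;
  fam_pd : forall (T I : finType) (c : I -> C) (g : I -> {perm T}), pow2 T ->
    0 <= \sum_i \sum_j (c i)^* * c j * V T (g i * (g j)^-1)%g;
  fam_one : forall T : finType, pow2 T -> V T 1%g = 1 }.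

Lemma fam_iso V (T U : finType) (f : T -> U) (p : {perm T}) (q : {perm U}) :
  charfam V -> pow2 T -> bijective f -> (forall x, q (f x) = f (p x)) -> V U q = V T p.
Proof.
move=> HV HT bf E; have HE : #|T| = #|U| := bij_eq_card bf.
apply: esym.
apply: (@fam_cov _ HV U T unit f (fun=> tt)) => //.
- by case: HT => n Hn; exists n; rewrite -HE.
- exact: pow2_unit.
- by rewrite card_unit muln1.
- by move=> x y [] /(bij_inj bf).
Qed.

Lemma fam_conj V (T : finType) (p q : {perm T}) :
  charfam V -> pow2 T -> V T (p ^ q)%g = V T p.
Proof.
move=> HV HT; apply: (@fam_iso V T T q) => //; first exact: injF_bij perm_inj.
by move=> x; rewrite /conjg !permM permK.
Qed.

Lemma fam_mulC V (T : finType) (p q : {perm T}) :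
  charfam V -> pow2 T -> V T (p * q)%g = V T (q * p)%g.
Proof. by move=> HV HT; rewrite -(fam_conj (p * q)%g p) // /conjg !mulgA mulVg mul1g. Qed.

Definition realizes (T : finType) (p : {perm T}) (s : S2elt) : Prop :=
  exists e : T -> (lvl s).-tuple bool, bijective e /\ forall x, e (p x) = sperm s (e x).

Lemma realizes_conj (T : finType) n (e : T -> n.-tuple bool) (p : {perm T}) :
  bijective e -> exists q : {perm n.-tuple bool}, forall x, e (p x) = q (e x).
Proof.
case=> e' eK e'K; exists (pfun (fun y => e (p (e' y)))) => x.
rewrite pfunE ?eK // => y z /(can_inj eK) /perm_inj; exact: can_inj e'K _ _.
Qed.

Lemma pow2_bij (T : finType) : pow2 T -> exists n (e : T -> n.-tuple bool), bijective e.
Proof.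
case=> n Hn; exists n; apply: eq_card_bij.
by rewrite card_tuple card_bool.
Qed.

Lemma realizes_ex (T : finType) (p : {perm T}) : pow2 T -> exists s, realizes p s.
Proof.
move=> /pow2_bij[n [e be]]; have [q Hq] := realizes_conj p be.
by exists (MkS2 q), e.
Qed.

Section OfCharacter.

Variables (chi : (X -> X) -> C) (Hchi : is_character chi).

Lemma chi_conj n (p q : {perm n.-tuple bool}) :
  chi (s2act (MkS2 (p ^ q)%g)) = chi (s2act (MkS2 p)).
Proof.
case: Hchi => Hc _ _.
by rewrite /conjg -s2act_comp Hc s2act_comp mulgK.
Qed.

(** Identifying [T] and [W] with tuples and concatenating conjugates [q'] to [up_perm m q], which
    acts on sequences as [q] does; centrality of [chi] absorbs the conjugation. With [T' = T] this
    shows that the identification chosen in [rep] is irrelevant. *)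
Lemma chi_realizes_cov (T T' W : finType) (f : T' -> T) (r : T' -> W)
    (p : {perm T}) (p' : {perm T'}) s s' :
  pow2 T -> pow2 W -> #|T'| = (#|T| * #|W|)%N -> injective (fun y => (f y, r y)) ->
  (forall y, f (p' y) = p (f y)) -> (forall y, r (p' y) = r y) ->
  realizes p s -> realizes p' s' -> chi (s2act s') = chi (s2act s).
Proof.
move=> _ [m Hm] HT' finj Hf Hr [e [be He]] [e' [be' He']].
case: s e be He => n q /= e be He; case: s' e' be' He' => n' q' /= e' be' He'.
have Hn' : n' = (n + m)%N.
  move: HT'; rewrite (bij_eq_card be) (bij_eq_card be') Hm !card_tuple !card_bool -expnD.
  exact: expnI.
subst n'.
have [b bb] : exists b : W -> m.-tuple bool, bijective b.
  by apply: eq_card_bij; rewrite Hm card_tuple card_bool.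
case: be' => d' e'K d'K.
pose h := pfun (fun y => [tuple of e (f (d' y)) ++ b (r (d' y))]).
have hE y : h y = [tuple of e (f (d' y)) ++ b (r (d' y))].
  rewrite pfunE // => y1 y2 E; apply: (can_inj d'K); apply: finj; congr (_, _).
    apply: (bij_inj be); rewrite -[LHS](@tfst_cat n m _ (b (r (d' y1)))) E.
    exact: tfst_cat.
  apply: (bij_inj bb); rewrite -[LHS](@tsnd_cat n m (e (f (d' y1)))) E.
  exact: tsnd_cat.
suff -> : q' = (up_perm m q ^ h^-1)%g by rewrite chi_conj s2act_up.
apply/permP => y; rewrite /conjg invgK !permM; apply: (@perm_inj _ h); rewrite permKV.
have Hd y' : d' (q' y') = p' (d' y') by rewrite -{1}(d'K y') -He' e'K.
by apply: tsplit_inj; rewrite tfst_up tsnd_up !hE !tfst_cat !tsnd_cat !Hd Hf Hr He.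
Qed.

Definition rep (T : finType) (p : {perm T}) : S2elt :=
  if pselect (exists s, realizes p s) is left h then projT1 (cid h)
  else MkS2 (1%g : {perm 0.-tuple bool}).

Lemma repP (T : finType) (p : {perm T}) : pow2 T -> realizes p (rep p).
Proof.
move=> HT; rewrite /rep; case: pselect => [h|[]]; last exact: realizes_ex.
by case: (cid h).
Qed.

Definition fam_of_char : family := fun T p => chi (s2act (rep p)).

Lemma fam_of_charE (T : finType) (p : {perm T}) s :
  pow2 T -> realizes p s -> fam_of_char p = chi (s2act s).
Proof.
move=> HT Hs; apply: (@chi_realizes_cov T T unit id (fun=> tt) p p) => //.
- exact: pow2_unit.
- by rewrite card_unit muln1.
- by move=> x y [].
- exact: repP.
Qed.

Lemma fam_of_char_sperm s : fam_of_char (sperm s) = chi (s2act s).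
Proof.
by apply: fam_of_charE; [exact: pow2_tuple | exists id; split => //; exists id].
Qed.

Lemma fam_of_charP : charfam fam_of_char.
Proof.
split.
- move=> T T' W f r p p' HT HW HT' finj Hf Hr.
  apply: (chi_realizes_cov HT HW HT' finj Hf Hr); first exact: repP.
  apply: repP; case: HT HW => n Hn [m Hm]; exists (n + m)%N.
  by rewrite HT' Hn Hm expnD.
- move=> T I c g HT; have [n [e be]] := pow2_bij HT.
  have /choice[q Hq] (p : {perm T}) :
      exists q : {perm n.-tuple bool}, forall x, e (p x) = q (e x).
    exact: realizes_conj.
  have [_ Hpd _] := Hchi.
  have := Hpd #|I| (fun k => MkS2 (q (g (enum_val k)))) (fun k => c (enum_val k)).
  suff -> : \sum_i \sum_j (c i)^* * c j * fam_of_char (g i * (g j)^-1)%g =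
    \sum_(i < #|I|) \sum_(j < #|I|) (c (enum_val i))^* * c (enum_val j) *
      chi (s2act (MkS2 (q (g (enum_val i)))) \o s2act (s2inv (MkS2 (q (g (enum_val j)))))) by [].
  rewrite (reindex _ (onW_bij _ (enum_val_bij I))) /=; apply: eq_bigr => i _.
  rewrite (reindex _ (onW_bij _ (enum_val_bij I))) /=; apply: eq_bigr => j _.
  congr (_ * _); have [Hc _ _] := Hchi.
  (* [s2act_comp] reverses the order of products, so centrality is used to restore the order of
     [fam_pd]. *)
  rewrite Hc /s2inv /= s2act_comp.
  apply: (@fam_of_charE T _ (MkS2 (q (g (enum_val i)) * (q (g (enum_val j)))^-1)%g) HT).
  exists e; split => //= x; rewrite !permM -Hq.
  by apply: (@perm_inj _ (q (g (enum_val j)))); rewrite permKV -Hq permKV.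
- move=> T HT; have [n [e be]] := pow2_bij HT.
  rewrite (@fam_of_charE _ _ (MkS2 (1%g : {perm n.-tuple bool}))) //.
    by rewrite s2act1; case: Hchi.
  by exists e; split => // x; rewrite !perm1.
Qed.

End OfCharacter.

Lemma fam_of_char_ex (chi : (X -> X) -> C) : is_character chi ->
  exists2 V : family, charfam V & forall s, chi (s2act s) = V _ (sperm s).
Proof.
move=> H; exists (fam_of_char chi); first exact: fam_of_charP.
by move=> s; rewrite fam_of_char_sperm.
Qed.

Lemma fam_lift V n m (p : {perm n.-tuple bool}) :
  charfam V -> V _ (up_perm m p) = V _ p.
Proof.
move=> HV; apply: (@fam_cov _ HV _ _ _ (@tfst n m) (@tsnd n m)).
- exact: pow2_tuple.
- exact: pow2_tuple.
- by rewrite !card_tuple expnD.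
- exact: tsplit_inj.
- exact: tfst_up.
- exact: tsnd_up.
Qed.

(** At the common level [n + m] the action determines the permutation, and lifting to that level
    preserves values. *)
Lemma fam_s2act_inj V s s' :
  charfam V -> s2act s = s2act s' -> V _ (sperm s) = V _ (sperm s').
Proof.
move=> HV; case: s s' => n p [m q] /= E.
have H (N k : nat) (e : k = N) (u : {perm k.-tuple bool}) :
    exists u' : {perm N.-tuple bool}, s2act (MkS2 u') = s2act (MkS2 u) /\ V _ u' = V _ u.
  by subst; exists u.
have [q' [Hq1 Hq2]] := H (n + m)%N _ (addnC m n) (up_perm n q).
rewrite -(fam_lift m p HV) -(fam_lift n q HV) -Hq2; congr (V _ _).
by apply: s2act_inj; rewrite Hq1 !s2act_up.
Qed.

Lemma is_character_fam V (chi : (X -> X) -> C) : charfam V ->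
  (forall s, chi (s2act s) = V _ (sperm s)) -> is_character chi.
Proof.
move=> HV Hchi; split.
- move=> g h; pose N := maxn (lvl g) (lvl h).
  have [qg [-> _]] := @s2_lift g N (leq_maxl _ _).
  have [qh [-> _]] := @s2_lift h N (leq_maxr _ _).
  by rewrite !s2act_comp !Hchi /= fam_mulC //; exact: pow2_tuple.
- move=> n g c; pose N := (\max_i lvl (g i))%N.
  have /choice[q Hq] i : exists q : {perm N.-tuple bool},
      s2act (g i) = s2act (MkS2 q) /\ s2act (s2inv (g i)) = s2act (MkS2 q^-1%g).
    by apply: s2_lift; exact: leq_bigmax.
  rewrite (_ : \sum_(i < n) _ = \sum_i \sum_j (c i)^* * c j * V _ (q i * (q j)^-1)%g).
    exact: fam_pd (pow2_tuple N).
  apply: eq_bigr => i _; apply: eq_bigr => j _; congr (_ * _).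
  rewrite (Hq i).1 (Hq j).2 s2act_comp Hchi /= fam_mulC //; exact: pow2_tuple.
- rewrite -(s2act1 0) Hchi /= fam_one //; exact: pow2_tuple.
Qed.

(** A character is encoded as a function on all maps of sequences, so it gets the value 0 off the
    group; on the group, [fam_s2act_inj] makes the choice of a representing element harmless. *)
Lemma char_of_fam V : charfam V ->
  exists2 chi : (X -> X) -> C, is_character chi & forall s, chi (s2act s) = V _ (sperm s).
Proof.
move=> HV; pose chi (f : X -> X) :=
  if pselect (exists s, f = s2act s) is left h then V _ (sperm (projT1 (cid h))) else 0.
have Hchi s : chi (s2act s) = V _ (sperm s).
  rewrite /chi; case: pselect => [h|[]]; last by exists s.
  by case: (cid h) => s' /= E; apply: fam_s2act_inj.
by exists chi => //; apply: is_character_fam Hchi.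
Qed.

End Families.

(** * Cauchy-Schwarz, products *)

Section Positivity.

Variable R : realType.
Local Notation C := R[i].
Local Notation family := (forall T : finType, {perm T} -> C).

Lemma mulc_conj (x : C) : x * x^* = `|x| ^+ 2.
Proof. exact: esym (normCK x). Qed.

Lemma mulc_conjl (x : C) : x^* * x = `|x| ^+ 2.
Proof. by rewrite mulrC mulc_conj. Qed.

Lemma archimedean_le0 (x y : C) : (forall M : nat, M.+1%:R * x <= y) -> x <= 0.
Proof.
(* Comparable complex numbers have equal imaginary parts; the multiples 1 and 2 of [x] thus force
   its imaginary part to vanish, and the real Archimedean property finishes. *)
move=> H; move: (H 0%N) (H 1%N); rewrite mul1r mulr_natl mulr2n !lecE raddfD /=.
move=> /andP[/eqP E1 _] /andP[/eqP E2 _].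
have Ex : complex.Im x = 0 by lra.
rewrite Ex eqxx /=; case: leP => // x0.
pose M := Num.Def.archi_bound (complex.Re y / complex.Re x).
have := H M; rewrite mulr_natl lecE => /andP[_].
rewrite raddfMn /= -mulr_natl -ler_pdivlMr // leNgt => /negP[].
have := archi_boundP; rewrite /M.
have [y0|y0] := lerP 0 (complex.Re y / complex.Re x); last first.
  by move=> _; apply: lt_trans y0 _; rewrite ltr0n.
move=> /(_ _ _ y0) h; apply: lt_trans h _; by rewrite ltr_nat.
Qed.

Variables (V : family) (HV : charfam V).

(** Positivity for [g] and 1 with coefficients 1 and [d] makes a quadratic form real; [d = 1] and
    [d = i] give linear equations for the imaginary and real parts. *)
Lemma fam_inv (T : finType) (g : {perm T}) : pow2 T -> V g^-1%g = (V g)^*.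
Proof.
move=> HT.
have H (d : C) := fam_pd HV (fun b : bool => if b then 1 else d)
  (fun b => if b then g else 1%g) HT.
have H1 := ger0_Im (H 1); have H2 := ger0_Im (H 'i%C).
rewrite -[RHS]/(conjc (V g)).
move: H1 H2; rewrite !big_bool /= !mulgV !invg1 mul1g mulg1 (fam_one HV HT).
rewrite -[1^*]/(conjc 1) -['i%C^*]/(conjc 'i%C).
case: (V g) (V g^-1%g) => [a b] [a' b']; simpc => /= H1 H2.
by apply/eqP; rewrite eq_complex /=; apply/andP; split; apply/eqP; lra.
Qed.

(** Cauchy-Schwarz for the vector of [z] and a combination of those of the [g i]: positivity is
    applied to the combination with its component [L] along [z] removed. *)
Lemma fam_CS (T I : finType) (c : I -> C) (g : I -> {perm T}) (z : {perm T}) : pow2 T ->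
  `|\sum_j c j * V (z * (g j)^-1)%g| ^+ 2 <= \sum_i \sum_j (c i)^* * c j * V (g i * (g j)^-1)%g.
Proof.
move=> HT; pose L := \sum_j c j * V (z * (g j)^-1)%g; pose Q := \sum_i \sum_j (c i)^* * c j * V (g i * (g j)^-1)%g.
rewrite -/L -/Q.
have := fam_pd HV (fun x : 'I_1 + I => match x with inl _ => - L | inr i => c i end)
  (fun x => match x with inl _ => z | inr i => g i end) HT.
rewrite big_sumType /= big_ord1 big_sumType /= big_ord1 mulgV (fam_one HV HT) mulr1.
under eq_bigr => j _ do rewrite -mulrA.
rewrite -mulr_sumr -/L.
under [X in _ + X]eq_bigr => i _ do rewrite big_sumType /= big_ord1.
rewrite big_split /= -/Q.
have -> : \sum_i (c i)^* * - L * V (g i * z^-1)%g = - L * L^*.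
  have -> : L^* = \sum_i (c i)^* * V (g i * z^-1)%g.
    rewrite [LHS]rmorph_sum; apply: eq_bigr => i _.
    by rewrite [LHS]rmorphM /= -(fam_inv _ HT) invMg invgK.
  by rewrite mulr_sumr; apply: eq_bigr => i _; ring.
rewrite rmorphN /= => H; rewrite -mulc_conj -subr_ge0; apply: le_trans H _.
by rewrite le_eqVlt; apply/orP; left; apply/eqP; ring.
Qed.

End Positivity.

(** * Permutations acting coordinatewise on products *)

Section Products.

Definition prod_perm (T U : finType) (s : {perm T}) (t : {perm U}) : {perm T * U} :=
  pfun (fun y => (s y.1, t y.2)).

Lemma prod_permE (T U : finType) (s : {perm T}) (t : {perm U}) y :
  prod_perm s t y = (s y.1, t y.2).
Proof. by rewrite pfunE // => -[a b] [a' b'] /= [/perm_inj-> /perm_inj->]. Qed.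

Lemma prod_permM (T U : finType) (s s' : {perm T}) (t t' : {perm U}) :
  (prod_perm s t * prod_perm s' t')%g = prod_perm (s * s') (t * t').
Proof. by apply/permP => y; rewrite permM !prod_permE !permM. Qed.

Lemma prod_perm1 (T U : finType) : prod_perm (1 : {perm T}) (1 : {perm U}) = 1%g.
Proof. by apply/permP => -[x y]; rewrite prod_permE !perm1. Qed.

Lemma prod_permV (T U : finType) (s : {perm T}) (t : {perm U}) :
  (prod_perm s t)^-1%g = prod_perm s^-1 t^-1.
Proof. by apply/eqP; rewrite eq_invg_mul prod_permM !mulgV prod_perm1. Qed.

Variables (I U : finType).
Implicit Types s t : I -> {perm U}.

Definition ffun_perm s : {perm {ffun I -> U}} := pfun (fun x : {ffun I -> U} => [ffun k => s k (x k)]).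

Lemma ffun_permE s x k : ffun_perm s x k = s k (x k).
Proof.
rewrite pfunE ?ffunE // => a b /ffunP E; apply/ffunP => l.
by have := E l; rewrite !ffunE => /perm_inj.
Qed.

Lemma ffun_permM s t : (ffun_perm s * ffun_perm t)%g = ffun_perm (fun k => s k * t k)%g.
Proof. by apply/permP => x; apply/ffunP => k; rewrite permM !ffun_permE permM. Qed.

Lemma ffun_permV s : (ffun_perm s)^-1%g = ffun_perm (fun k => (s k)^-1)%g.
Proof.
apply/eqP; rewrite eq_invg_mul ffun_permM; apply/eqP/permP => x; apply/ffunP => k.
by rewrite ffun_permE mulgV !perm1.
Qed.

Variables (R : realType) (V : forall T : finType, {perm T} -> R[i]) (HV : charfam V).
Hypothesis HU : pow2 U.

Lemma fam_ffun1 s i : (forall k, k != i -> s k = 1%g) -> V (ffun_perm s) = V (s i).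
Proof.
move=> Hs.
apply: (@fam_cov _ _ HV U _ {ffun {k | k != i} -> U} (fun x : {ffun I -> U} => x i)
  (fun x : {ffun I -> U} => [ffun k => x (val k)])) => //.
- exact: pow2_ffun.
- rewrite !card_ffun card_sig -expnS; congr (_ ^ _)%N.
  by rewrite (cardD1 i) inE add1n; congr S; apply: eq_card => k; rewrite !inE andbT.
- move=> x y [E1 /ffunP E2]; apply/ffunP => k; have [->//|ki] := eqVneq k i.
  by have := E2 (exist _ k ki); rewrite !ffunE.
- by move=> y; rewrite ffun_permE.
- by move=> y; apply/ffunP => -[k ki]; rewrite !ffunE ffun_permE /= Hs // perm1.
Qed.

Lemma fam_ffun2 s i j : i != j -> (forall k, k != i -> k != j -> s k = 1%g) ->
  V (ffun_perm s) = V (prod_perm (s i) (s j)).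
Proof.
move=> ij Hs.
apply: (@fam_cov _ _ HV _ _ {ffun {k | (k != i) && (k != j)} -> U} (fun x : {ffun I -> U} => (x i, x j))
  (fun x : {ffun I -> U} => [ffun k => x (val k)])) => //.
- exact: pow2_prod.
- exact: pow2_ffun.
- rewrite card_prod !card_ffun card_sig -mulnA -!expnS; congr (_ ^ _)%N.
  rewrite (cardD1 i) inE (cardD1 j) !inE eq_sym ij; congr _.+2; apply: eq_card => k.
  by rewrite !inE andbT andbC.
- move=> x y [E1 E1' /ffunP E2]; apply/ffunP => k.
  have [->//|ki] := eqVneq k i; have [->//|kj] := eqVneq k j.
  have kij : (k != i) && (k != j) by rewrite ki.
  by have := E2 (exist _ k kij); rewrite !ffunE.
- by move=> y; rewrite !ffun_permE prod_permE.
- move=> y; apply/ffunP => -[k kij]; rewrite !ffunE ffun_permE /=.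
  by case/andP: kij => ki kj; rewrite Hs // perm1.
Qed.

End Products.

Section Squares.

Variables (R : realType) (V : forall T : finType, {perm T} -> R[i]) (HV : charfam V).

Lemma sum_diag (M : nat) (b : R[i]) :
  \sum_(i < M) \sum_(j < M) (if i == j then 1 else b) = M%:R * (1 + (M%:R - 1) * b).
Proof.
rewrite -[M in M%:R * _]card_ord -sum1_card natr_sum mulr_suml.
apply: eq_bigr => i _; rewrite mul1r (bigD1 i) //= eqxx.
rewrite (eq_bigr (fun=> b)); last by move=> j /negbTE; rewrite eq_sym => ->.
congr (_ + _); rewrite sumr_const cardC1 card_ord.
by case: M i => [[]//|M] i /=; rewrite -natr1 addrK mulr_natl.
Qed.

(* Copies of [s] acting on [M] independent blocks of coordinates have pairwise inner products
   [V (s x s^-1)]; Cauchy-Schwarz against the unit vector, then M -> oo. *)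
Lemma fam_sq (U : finType) (s : {perm U}) : pow2 U ->
  `|V s| ^+ 2 <= V (prod_perm s s^-1).
Proof.
move=> HU; rewrite -subr_le0.
apply: (@archimedean_le0 _ _ (1 - V (prod_perm s s^-1))) => m.
pose M := m.+1; pose blk (i : 'I_M) := @ffun_perm 'I_M U (fun k => if k == i then s else 1%g).
have := @fam_CS _ _ HV _ _ (fun=> 1) blk 1%g (pow2_ffun _ HU).
have -> : \sum_j 1 * V (1 * (blk j)^-1)%g = M%:R * V s^-1%g.
  rewrite -[M in M%:R]card_ord -sum1_card natr_sum mulr_suml.
  apply: eq_bigr => j _; rewrite mul1g /blk ffun_permV !mul1r (@fam_ffun1 _ _ _ _ HV HU _ j).
    by rewrite eqxx.
  by move=> k /negbTE ->; rewrite invg1.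
have -> : \sum_i \sum_j 1^* * 1 * V (blk i * (blk j)^-1)%g =
    M%:R * (1 + (M%:R - 1) * V (prod_perm s s^-1)).
  rewrite -sum_diag; apply: eq_bigr => i _; apply: eq_bigr => j _.
  rewrite conjC1 !mul1r; have [->|ij] := eqVneq i j.
    by rewrite mulgV fam_one //; exact: pow2_ffun.
  rewrite /blk ffun_permV ffun_permM (@fam_ffun2 _ _ _ _ HV HU _ i j ij).
    by rewrite !eqxx (negbTE ij) eq_sym (negbTE ij) invg1 mulg1 mul1g.
  by move=> k /negbTE -> /negbTE ->; rewrite mulgV.
rewrite normrM exprMn normr_nat fam_inv // norm_conjC.
rewrite [M%:R ^+ 2]expr2 -mulrA ler_pM2l ?ltr0n // => H.
rewrite mulrBr lerBlDr; apply: le_trans H _.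
by rewrite -[m.+1]/M le_eqVlt; apply/orP; left; apply/eqP; ring.
Qed.

End Squares.

(** * Powers of the measure of the fixed point set *)

Definition nfix (T : finType) (p : {perm T}) : nat := #|[set x | p x == x]|.

Lemma nfix_cov (T T' W : finType) (f : T' -> T) (r : T' -> W) (p : {perm T}) (p' : {perm T'}) :
  #|T'| = (#|T| * #|W|)%N -> injective (fun y => (f y, r y)) ->
  (forall y, f (p' y) = p (f y)) -> (forall y, r (p' y) = r y) ->
  nfix p' = (nfix p * #|W|)%N.
Proof.
move=> HT' finj Hf Hr.
have [h hK Kh] : bijective (fun y => (f y, r y)).
  by apply: inj_card_bij => //; rewrite card_prod HT'.
rewrite /nfix -[in RHS]cardsT -cardsX -(card_imset _ finj).
apply: eq_card => -[x w]; rewrite !inE andbT /=; apply/imsetP/idP => [[y]|xx].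
  by rewrite inE => /eqP E [-> _]; rewrite -Hf E.
exists (h (x, w)); last by rewrite Kh.
have [E1 E2] : f (h (x, w)) = x /\ r (h (x, w)) = w by case: (Kh (x, w)).
by rewrite inE; apply/eqP/finj; rewrite Hf Hr E1 (eqP xx).
Qed.

Lemma nfix_prod (T U : finType) (s : {perm T}) (t : {perm U}) :
  nfix (prod_perm s t) = (nfix s * nfix t)%N.
Proof.
rewrite /nfix -cardsX; apply: eq_card => -[x y].
by rewrite !inE prod_permE xpair_eqE.
Qed.

Lemma nfixV (T : finType) (s : {perm T}) : nfix s^-1 = nfix s.
Proof.
by apply: eq_card => x; rewrite !inE -(inj_eq (@perm_inj _ s)) permKV eq_sym.
Qed.

Lemma nfix_le (T : finType) (s : {perm T}) : (nfix s <= #|T|)%N.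
Proof. exact: max_card. Qed.

Lemma nfix1 (T : finType) : nfix (1 : {perm T}) = #|T|.
Proof. by rewrite /nfix -cardsT; apply: eq_card => x; rewrite !inE perm1 eqxx. Qed.

Lemma nfix_full (T : finType) (s : {perm T}) : nfix s = #|T| -> s = 1%g.
Proof.
move=> E; apply/permP => x; rewrite perm1; apply/eqP.
have /eqP : [set x | s x == x] == setT by rewrite eqEcard subsetT cardsT -E /= /nfix.
by move/setP/(_ x); rewrite !inE.
Qed.

Section PowerCharacters.

Variable R : realType.
Local Notation C := R[i].

Definition fixratio (T : finType) (p : {perm T}) : R := (nfix p)%:R / #|T|%:R.

Lemma muFixE (s : S2elt) : muFix s = fixratio (sperm s).
Proof.
by rewrite /muFix /mu_cyl /fixratio /nfix /FixBase card_tuple card_bool natrX.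
Qed.

Lemma fixratio_bounds (T : finType) (p : {perm T}) : pow2 T -> 0 <= fixratio p <= 1.
Proof.
move=> /pow2_gt0 HT; rewrite divr_ge0 ?ler0n //= ler_pdivrMr ?ltr0n // mul1r ler_nat.
exact: nfix_le.
Qed.

Lemma fixratio_prod (T U : finType) (s : {perm T}) (t : {perm U}) :
  fixratio (prod_perm s t) = fixratio s * fixratio t.
Proof. by rewrite /fixratio nfix_prod card_prod !natrM mulf_div. Qed.

Lemma fixratioV (T : finType) (s : {perm T}) : fixratio s^-1 = fixratio s.
Proof. by rewrite /fixratio nfixV. Qed.

Lemma powinfM (x y : R) a : 0 <= x <= 1 -> 0 <= y <= 1 ->
  powinf (x * y) a = powinf x a * powinf y a.
Proof.
case: a => [k|] /= Hx Hy; first by rewrite exprMn.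
(* For the infinite exponent: a product of two numbers in [0,1] is 1 only if both are. *)
have [->|x1] := eqVneq x 1; first by rewrite !mul1r.
rewrite mul0r ifF //; apply/eqP => E.
have x1' : x < 1 by rewrite lt_neqAle x1; case/andP: Hx.
nra.
Qed.

(** Grouping the indices by the value of [u] turns the double sum into a sum of squared moduli. *)
Lemma sum_eq_ge0 (I B : finType) (u : I -> B) (c : I -> C) :
  0 <= \sum_i \sum_j (c i)^* * c j * (u i == u j)%:R.
Proof.
rewrite (_ : \sum_i _ = \sum_b (\sum_(i | u i == b) c i)^* * (\sum_(i | u i == b) c i)).
  by apply: sumr_ge0 => b _; rewrite mulc_conjl exprn_ge0.
rewrite (partition_big u xpredT) //=; apply: eq_bigr => b _.
rewrite rmorph_sum mulr_suml; apply: eq_bigr => i /eqP <-.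
rewrite mulr_sumr [RHS]big_mkcond /=; apply: eq_bigr => j _.
by rewrite eq_sym; case: eqP; rewrite ?mulr1 ?mulr0.
Qed.

Definition powfam (a : option nat) : forall T : finType, {perm T} -> C :=
  fun T p => (powinf (fixratio p) a)%:C%C.

(* Positivity: the k-th power of the number of fixed points counts the fixed points on T^k. *)
Lemma powfamP a : charfam (powfam a).
Proof.
split.
- move=> T T' W f r p p' HT HW HT' finj Hf Hr; rewrite /powfam /fixratio.
  rewrite (nfix_cov HT' finj Hf Hr) HT' !natrM -mulf_div divff ?mulr1 //.
  by rewrite pnatr_eq0 -lt0n pow2_gt0.
- move=> T I c g HT; rewrite /powfam; case: a => [k|] /=.
    (* The term of [x] tests whether [g i] and [g j] agree on all coordinates of [x], that is,
       whether their quotient fixes [x]. *)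
    rewrite (_ : \sum_i _ = \sum_(x : {ffun 'I_k -> T}) (#|T|%:R ^- k) *
      \sum_i \sum_j (c i)^* * c j * ([ffun l => g i (x l)] == [ffun l => g j (x l)])%:R).
      apply: sumr_ge0 => x _; apply: mulr_ge0; first by rewrite invr_ge0 exprn_ge0 ?ler0n.
      exact: (@sum_eq_ge0 _ _ (fun i => [ffun l => g i (x l)]) c).
    rewrite -mulr_sumr [in RHS]exchange_big mulr_sumr /=; apply: eq_bigr => i _.
    rewrite [in RHS]exchange_big mulr_sumr /=; apply: eq_bigr => j _.
    rewrite -mulr_sumr mulrCA; congr (_ * _).
    rewrite /fixratio exprMn rmorphM exprVn rmorphXn /= fmorphV rmorphXn !rmorph_nat mulrC.
    congr (_ * _); rewrite -natrX -natr_sum; congr _%:R.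
    rewrite /nfix -[k in LHS]card_ord -card_ffun_on -sum1_card [LHS]big_mkcond.
    apply: eq_bigr => x _ /=.
    rewrite (_ : (x \in _) = ([ffun l => g i (x l)] == [ffun l => g j (x l)])); first by case: eqP.
    apply/ffun_onP/eqP => [H|/ffunP H].
      apply/ffunP => l; have := H l; rewrite !ffunE inE permM.
      by rewrite -(inj_eq (@perm_inj _ (g j))) permKV => /eqP.
    move=> l; have := H l; rewrite !ffunE inE permM => ->; by rewrite permK.
  (* Only the identity has fixed ratio 1, so for the infinite exponent the kernel is the indicator
     of [g i = g j]. *)
  rewrite (_ : \sum_i _ = \sum_i \sum_j (c i)^* * c j * (g i == g j)%:R); first exact: sum_eq_ge0.
  apply: eq_bigr => i _; apply: eq_bigr => j _; congr (_ * _).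
  rewrite (_ : (fixratio _ == 1) = (g i == g j)); first by case: eqP.
  apply/eqP/eqP => [|->]; last first.
    by rewrite mulgV /fixratio nfix1 divff // pnatr_eq0 -lt0n pow2_gt0.
  move=> /divr1_eq /eqP; rewrite eqr_nat => /eqP /nfix_full E.
  by rewrite -[g i](mulgKV (g j)) E mul1g.
- move=> T HT; rewrite /powfam /fixratio nfix1 divff ?pnatr_eq0 -?lt0n ?pow2_gt0 //.
  by case: a => [k|] /=; rewrite ?expr1n ?eqxx.
Qed.

Lemma fam_realizes (V : forall T : finType, {perm T} -> C) (T : finType) (p : {perm T}) s :
  charfam V -> pow2 T -> realizes p s -> V _ p = V _ (sperm s).
Proof.
by move=> HV HT [e [be He]]; apply: esym; apply: (fam_iso HV HT be) => x; rewrite He.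
Qed.

Lemma powfam_indecomposable (chi : (X -> X) -> C) a :
  (forall s, chi (s2act s) = (powinf (muFix s : R) a)%:C%C) ->
  is_indecomposable_character chi.
Proof.
move=> Hchi.
have Hchi' s : chi (s2act s) = powfam a (sperm s) by rewrite Hchi muFixE.
split; first exact: is_character_fam (powfamP a) Hchi'.
case=> t [chi1 [chi2 [Ht Hchi1 Hchi2 Hsum [s]]]]; case/andP: Ht => t0 t1.
have [V1 HV1 E1] := fam_of_char_ex Hchi1; have [V2 HV2 E2] := fam_of_char_ex Hchi2.
apply; rewrite E1 E2.
have Hsum' (T : finType) (p : {perm T}) : pow2 T ->
    powfam a p = t%:C%C * V1 T p + (1 - t)%:C%C * V2 T p.
  move=> HT; have [s' Hs'] := realizes_ex p HT.
  rewrite !(@fam_realizes _ _ _ s' _ HT Hs') //; last exact: powfamP.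
  by rewrite -Hchi' Hsum E1 E2.
have HT := pow2_tuple (lvl s).
have := Hsum' _ (prod_perm (sperm s) (sperm s)^-1) (pow2_prod HT HT).
have := Hsum' _ (sperm s) HT; move: (fam_sq HV1 (sperm s) HT) (fam_sq HV2 (sperm s) HT).
rewrite /powfam fixratio_prod powinfM ?fixratio_bounds // fixratioV.
move: (V1 _ (prod_perm _ _)) (V2 _ (prod_perm _ _)) => b1 b2.
move: (V1 _ _) (V2 _ _) (powinf _ _) => v1 v2 c H1 H2 Hv Hb.
(* [fam_sq] holds for both constituents, while [powfam] attains equality because [fixratio] is
   multiplicative and invariant under inversion. *)
have K : t%:C%C * `|v1| ^+ 2 + (1 - t)%:C%C * `|v2| ^+ 2 <= (c * c)%:C%C.
  by rewrite Hb; apply: lerD; apply: ler_wpM2l => //; rewrite ler0c; lra.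
have cc : (c * c)%:C%C = (t%:C%C * v1 + (1 - t)%:C%C * v2) * (t%:C%C * v1 + (1 - t)%:C%C * v2)^*.
  by rewrite -Hv [_^*]conjc_real rmorphM.
have tR : (t%:C%C)^* = t%:C%C := conjc_real t.
have t1E : (1 - t)%:C%C = 1 - t%:C%C by rewrite rmorphB rmorph1.
(* The left side is the variance [t |v1|^2 + (1 - t) |v2|^2 - |t v1 + (1 - t) v2|^2]. *)
have : (t * (1 - t))%:C%C * `|v1 - v2| ^+ 2 <= 0.
  have -> : (t * (1 - t))%:C%C = t%:C%C * (1 - t%:C%C) by rewrite rmorphM -t1E.
  move: K; rewrite cc t1E; move: (t%:C%C) tR => u uR; rewrite -subr_ge0 => K.
  rewrite -oppr_ge0; move: K.
  rewrite -!mulc_conj !(rmorphB, rmorphD, rmorphM) /= rmorph1 uR => K.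
  apply: le_trans K _; rewrite le_eqVlt; apply/orP; left; apply/eqP; ring.
rewrite pmulr_rle0; last by rewrite ltcR mulr_gt0 // subr_gt0.
move=> H; have : `|v1 - v2| ^+ 2 == 0 by rewrite eq_le H exprn_ge0.
by rewrite expf_eq0 /= normr_eq0 subr_eq0 => /eqP.
Qed.

End PowerCharacters.

(** * Dependence on the measure of the fixed point set *)

Section Involutions.

Lemma invol_standard (T : finType) (s : {perm T}) : (s * s = 1)%g ->
  exists d (f : 'I_(nfix s) + 'I_d * bool -> T), [/\ bijective f,
    forall i, s (f (inl i)) = f (inl i) & forall j b, s (f (inr (j, b))) = f (inr (j, ~~ b))].
Proof.
move=> ss; have sK x : s (s x) = x by rewrite -permM ss perm1.
(* [D] picks from each 2-cycle the point of smaller rank; the bit in [f] tells it from its image. *)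
pose D := [set x | (enum_rank x < enum_rank (s x))%N].
pose f (u : 'I_(nfix s) + 'I_#|D| * bool) := match u with
  | inl i => enum_val i | inr (j, b) => if b then s (enum_val j) else enum_val j end.
have HD (j : 'I_#|D|) : (enum_rank (enum_val j) < enum_rank (s (enum_val j)))%N.
  by have := enum_valP j; rewrite inE.
have HF (i : 'I_(nfix s)) : s (enum_val i) = enum_val i.
  by have := enum_valP i; rewrite inE => /eqP.
have HFD (i : 'I_(nfix s)) (j : 'I_#|D|) : enum_val i <> enum_val j :> T.
  by move=> E; have := HD j; rewrite -E HF ltnn.
have HFD' (i : 'I_(nfix s)) (j : 'I_#|D|) : enum_val i <> s (enum_val j) :> T.
  by move=> E; apply: (HFD i j); rewrite -HF E sK.
have HDD (j k : 'I_#|D|) : enum_val j <> s (enum_val k) :> T.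
  by move=> E; have := HD j; have := HD k; rewrite E sK; lia.
exists #|D|, f; split; last first.
- by move=> j [] /=; rewrite ?sK.
- by move=> i /=.
apply: inj_card_bij.
  move=> [i|[j b]] [i'|[j' b']] /=.
  - by move=> /enum_val_inj->.
  - by case: b' => E; [case: (HFD' i j') | case: (HFD i j')].
  - by case: b => E; [case: (HFD' i' j) | case: (HFD i' j)].
  - case: b; case: b'.
    + by move=> /perm_inj /enum_val_inj->.
    + by move=> E; case: (HDD j' j).
    + by move=> E; case: (HDD j j').
    + by move=> /enum_val_inj->.
rewrite -[X in (X <= _)%N]cardsT -[X in (_ <= X)%N]cardsT.
rewrite -(_ : [set f u | u in setT] = setT) ?leq_imset_card //.
apply/setP => x; rewrite !inE; apply/imsetP.
have [xx|xx] := eqVneq (s x) x.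
  have xF : x \in [set x | s x == x] by rewrite inE xx.
  by exists (inl (enum_rank_in xF x)) => //=; rewrite enum_rankK_in.
have [xD|xD] := boolP (x \in D).
  by exists (inr (enum_rank_in xD x, false)) => //=; rewrite enum_rankK_in.
have sxD : s x \in D.
  move: xD; rewrite !inE sK -leqNgt leq_eqVlt => /orP[/eqP/val_inj/enum_rank_inj E|//].
  by rewrite E eqxx in xx.
by exists (inr (enum_rank_in sxD (s x), true)) => //=; rewrite enum_rankK_in // sK.
Qed.

Lemma invol_conj (T : finType) (s t : {perm T}) : (s * s = 1)%g -> (t * t = 1)%g ->
  nfix s = nfix t -> exists2 r : T -> T, bijective r & forall x, t (r x) = r (s x).
Proof.
move=> /invol_standard[d [f [bf f1 f2]]] /invol_standard[e [g [bg g1 g2]]] E.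
have de : d = e.
  have := bij_eq_card bf; have := bij_eq_card bg.
  by rewrite !card_sum !card_prod !card_ord card_bool E; lia.
subst e; rewrite -E in g bg g1 g2.
case: bf => f' fK f'K; exists (g \o f'); first by apply: bij_comp => //; exists f.
move=> x /=; rewrite -{2}(f'K x); case: (f' x) => [i|[j b]].
  by rewrite f1 fK g1.
by rewrite f2 fK g2.
Qed.

Variables (R : realType) (V : forall T : finType, {perm T} -> R[i]) (HV : charfam V).

Lemma fam_prod_1r (T U : finType) (p : {perm T}) :
  pow2 T -> pow2 U -> V (prod_perm p (1 : {perm U})) = V p.
Proof.
move=> HT HU; apply: (@fam_cov _ _ HV T _ U fst snd) => //.
- by rewrite card_prod.
- by move=> [? ?] [? ?] [-> ->].
- by move=> y; rewrite prod_permE.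
- by move=> y; rewrite prod_permE perm1.
Qed.

Lemma fam_prod_1l (T U : finType) (p : {perm U}) :
  pow2 T -> pow2 U -> V (prod_perm (1 : {perm T}) p) = V p.
Proof.
move=> HT HU; apply: (@fam_cov _ _ HV U _ T snd fst) => //.
- by rewrite card_prod mulnC.
- by move=> [? ?] [? ?] [-> ->].
- by move=> y; rewrite prod_permE.
- by move=> y; rewrite prod_permE perm1.
Qed.

(** On [T * T'] the two extensions by the identity are involutions with equally many fixed points,
    hence conjugate. Equality of the fixed ratios is cross-multiplied to stay in [nat]. *)
Lemma fam_invol (T T' : finType) (p : {perm T}) (p' : {perm T'}) : pow2 T -> pow2 T' ->
  (p * p = 1)%g -> (p' * p' = 1)%g -> (nfix p * #|T'| = nfix p' * #|T|)%N -> V p = V p'.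
Proof.
move=> HT HT' pp pp' E.
rewrite -(fam_prod_1r p HT HT') -(fam_prod_1l p' HT HT').
have [||| r br Hr] := @invol_conj _ (prod_perm (1 : {perm T}) p') (prod_perm p (1 : {perm T'})).
- by rewrite prod_permM pp' mulg1 prod_perm1.
- by rewrite prod_permM pp mulg1 prod_perm1.
- by rewrite !nfix_prod !nfix1 E mulnC.
by apply: (fam_iso HV _ br Hr); exact: pow2_prod.
Qed.

Lemma fam_invol_real (T : finType) (p : {perm T}) : pow2 T -> (p * p = 1)%g -> (V p)^* = V p.
Proof.
move=> HT pp; rewrite -fam_inv //; congr V; apply/eqP; by rewrite eq_invg_mul pp.
Qed.

End Involutions.

(** * Skew products with fibre a vector space over the two-element field *)

HB.instance Definition _ := GRing.isZmodule.Build bool addbA addbC addFb addbb.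

Section SkewProducts.

Variables I U : finType.
Local Notation K := {ffun I -> bool}.
Implicit Types (s : {perm U}) (t : U -> K) (A : {set U}).

Lemma addKK (a : K) : a + a = 0.
Proof. by apply/ffunP => k; rewrite !ffunE; exact: addbb. Qed.

Lemma addKA (a b : K) : a + b + b = a.
Proof. by rewrite -addrA addKK addr0. Qed.

(** With exclusive or as addition the fibre is a vector space with basis [delta]; distinct basis
    vectors supply independent translations. *)
Definition skew s t : {perm U * K} := pfun (fun y : U * K => (s y.1, y.2 + t y.1)).

Lemma skewE s t y : skew s t y = (s y.1, y.2 + t y.1).
Proof. by rewrite pfunE // => -[x a] [x' a'] /= [/perm_inj-> /addIr->]. Qed.

Lemma eq_skew s t t' : t =1 t' -> skew s t = skew s t'.
Proof. by move=> E; apply/permP => y; rewrite !skewE E. Qed.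

Lemma skewM s t s' t' : (skew s t * skew s' t')%g = skew (s * s') (fun x => t x + t' (s x)).
Proof. by apply/permP => y; rewrite permM !skewE permM addrA. Qed.

Lemma skew1 t : (forall x, t x = 0) -> skew 1 t = 1%g.
Proof. by move=> t0; apply/permP => -[x a]; rewrite skewE !perm1 t0 addr0. Qed.

Lemma skewV s t : (skew s t)^-1%g = skew s^-1 (fun x => t (s^-1%g x)).
Proof.
apply/eqP; rewrite eq_invg_mul skewM mulgV; apply/eqP/skew1 => x.
by rewrite permK addKK.
Qed.

Lemma skew_invol s t : (s * s = 1)%g -> (forall x, t (s x) = t x) -> (skew s t * skew s t = 1)%g.
Proof. by move=> ss Ht; rewrite skewM ss; apply: skew1 => x; rewrite Ht addKK. Qed.

Lemma nfix_skew s t :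
  nfix (skew s t) = (#|[set x | (s x == x) && (t x == 0%R)]| * #|{ffun I -> bool}|)%N.
Proof.
rewrite /nfix -cardsT -cardsX; apply: eq_card => -[x a]; rewrite !inE skewE xpair_eqE andbT.
by rewrite -subr_eq0 [a + _]addrC addrK.
Qed.

Definition delta (i : I) : K := [ffun k => k == i].

Lemma delta_neq0 i : delta i != 0.
Proof. by apply/eqP => /ffunP/(_ i); rewrite !ffunE eqxx. Qed.

Lemma delta_inj : injective delta.
Proof. by move=> i j /ffunP/(_ i); rewrite !ffunE eqxx => /esym/eqP. Qed.

Lemma addK_eq0 (a b : K) : (a + b == 0) = (a == b).
Proof. by apply/eqP/eqP => [E|->]; rewrite ?addKK // -(addKA a b) E add0r. Qed.

Definition ind A (e : K) (x : U) : K := if x \in A then e else 0.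

Lemma ind_eq0 A e x : e != 0 -> (ind A e x == 0) = (x \notin A).
Proof. by rewrite /ind; case: ifP => _ /negbTE e0; rewrite ?e0 ?eqxx. Qed.

End SkewProducts.

Lemma pow2_K (I U : finType) : pow2 U -> pow2 (U * {ffun I -> bool})%type.
Proof. by move=> HU; apply: pow2_prod => //; apply: pow2_ffun; apply: pow2_bool. Qed.

(** * Reduction of arbitrary permutations to involutions by averaging *)

Section FixedPoints.

Variables (R : realType) (V : forall T : finType, {perm T} -> R[i]) (HV : charfam V).
Local Notation C := R[i].

(** The Gram entries make the squared norm of the difference of the two sums equal to
    [2 * m.+1 * (1 - F)]; Cauchy-Schwarz against the vector of [z] bounds [m.+1 ^ 2 * |a - b| ^ 2]
    by it. *)
Lemma two_families_bound (T : finType) (m : nat) (u w : 'I_m.+1 -> {perm T}) (z : {perm T})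
    (F a b : C) : pow2 T ->
  (forall i j, i != j -> V (u i * (u j)^-1)%g = F) ->
  (forall i j, i != j -> V (w i * (w j)^-1)%g = F) ->
  (forall i j, V (u i * (w j)^-1)%g = F) -> (forall i j, V (w i * (u j)^-1)%g = F) ->
  (forall i, V (z * (u i)^-1)%g = a) -> (forall i, V (z * (w i)^-1)%g = b) ->
  m.+1%:R * `|a - b| ^+ 2 <= 2 * (1 - F).
Proof.
move=> HT Hu Hw Huw Hwu Ha Hb; pose M := m.+1.
have := @fam_CS _ _ HV _ _ (fun x : 'I_M + 'I_M => if x is inl _ then 1 else -1)
  (fun x => match x with inl i => u i | inr i => w i end) z HT.
have sumM (x : C) : \sum_(i < M) x = M%:R * x by rewrite sumr_const card_ord mulr_natl.
rewrite big_sumType /=.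
under eq_bigr => i _ do rewrite Ha mul1r.
under [X in _ + X]eq_bigr => i _ do rewrite Hb mulN1r.
rewrite !sumM mulrN -mulrBr normrM exprMn normr_nat.
rewrite big_sumType /= !(eq_bigr _ (fun i _ => big_sumType _ _ _)) /= !big_split /=.
under eq_bigr => i _ do under eq_bigr => j _ do rewrite conjC1 !mul1r.
have E1 : \sum_(i < M) \sum_(j < M) V (u i * (u j)^-1)%g = M%:R * (1 + (M%:R - 1) * F).
  rewrite -sum_diag; apply: eq_bigr => i _; apply: eq_bigr => j _.
  by have [->|/Hu//] := eqVneq i j; rewrite mulgV fam_one.
have E2 : \sum_(i < M) \sum_(j < M) (-1)^* * -1 * V (w i * (w j)^-1)%g =
    M%:R * (1 + (M%:R - 1) * F).
  rewrite -sum_diag; apply: eq_bigr => i _; apply: eq_bigr => j _.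
  rewrite rmorphN1 mulrNN !mul1r.
  by have [->|/Hw//] := eqVneq i j; rewrite mulgV fam_one.
rewrite E1 E2.
have E3 : \sum_(i < M) \sum_(j < M) 1^* * -1 * V (u i * (w j)^-1)%g = M%:R * (M%:R * - F).
  rewrite -!sumM; apply: eq_bigr => i _; apply: eq_bigr => j _.
  by rewrite Huw conjC1 mul1r mulN1r.
have E4 : \sum_(i < M) \sum_(j < M) (-1)^* * 1 * V (w i * (u j)^-1)%g = M%:R * (M%:R * - F).
  rewrite -!sumM; apply: eq_bigr => i _; apply: eq_bigr => j _.
  by rewrite Hwu rmorphN1 mulr1 mulN1r.
rewrite E3 E4 [M%:R ^+ 2]expr2 -mulrA => H.
rewrite -(@ler_pM2l _ M%:R) ?ltr0n //; apply: le_trans H _.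
by rewrite le_eqVlt; apply/orP; left; apply/eqP; ring.
Qed.

Lemma norm2_le0 (x : C) : `|x| ^+ 2 <= 0 -> x = 0.
Proof.
move=> H; have : `|x| ^+ 2 == 0 by rewrite eq_le H exprn_ge0.
by rewrite expf_eq0 /= normr_eq0 => /eqP.
Qed.

(** For [z] preserving [A], this is the inner product of [z] with a translation over [A] by a fresh
    bit; at [z = 1] it is the value on an involution moving exactly the points over [A]. *)
Definition kappa (U : finType) (A : {set U}) (z : {perm U}) : C :=
  V (skew z (ind A (delta tt))).

Lemma fam_skew_delta (I U : finType) (A : {set U}) (z : {perm U}) (i : I) : pow2 U ->
  V (skew z (ind A (delta i))) = kappa A z.
Proof.
move=> HU; apply: (@fam_cov _ _ HV _ _ {ffun {k | k != i} -> bool}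
  (fun y : U * {ffun I -> bool} => (y.1, [ffun _ => y.2 i]))
  (fun y => [ffun k => y.2 (val k)])).
- exact: pow2_K.
- exact: pow2_ffun pow2_bool.
- rewrite !card_prod !card_ffun card_sig card_unit -mulnA -expnD; congr (_ * _ ^ _)%N.
  by rewrite (cardD1 i) inE; congr (1 + _)%N; apply: eq_card => k; rewrite !inE andbT.
- move=> [x a] [x' a'] [-> /ffunP/(_ tt) + /ffunP E2]; rewrite !ffunE /= => E1.
  congr (_, _); apply/ffunP => k; have [->//|ki] := eqVneq k i.
  by have := E2 (exist _ k ki); rewrite !ffunE.
- move=> [x a]; rewrite !skewE /=; congr (_, _); apply/ffunP => k; rewrite !ffunE /ind.
  by case: ifP => _; rewrite !ffunE ?eqxx.
- move=> [x a]; rewrite !skewE /=; apply/ffunP => -[k ki]; rewrite !ffunE /= /ind.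
  by case: ifP => _; rewrite !ffunE ?(negbTE ki) addr0.
Qed.

(** Used to compute Gram entries: invariance of [t] under [a] makes the skew product an involution,
    and it moves exactly the points over [A]. *)
Lemma fam_skew_invol (I U : finType) (A : {set U}) (a : {perm U}) (t : U -> {ffun I -> bool}) :
  pow2 U -> (a * a = 1)%g -> (forall x, t (a x) = t x) ->
  (forall x, (a x == x) && (t x == 0) = (x \notin A)) -> V (skew a t) = kappa A 1.
Proof.
move=> HU aa Ht HA; apply: fam_invol => //; try exact: pow2_K.
- exact: skew_invol.
- by apply: skew_invol; [rewrite mulg1 | move=> x; rewrite perm1].
rewrite !nfix_skew !card_prod.
have -> : [set x | (a x == x) && (t x == 0)] = ~: A by apply/setP => x; rewrite !inE HA.
have -> : [set x | ((1%g : {perm U}) x == x) && (ind A (delta tt) x == 0)] = ~: A.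
  by apply/setP => x; rewrite !inE perm1 eqxx ind_eq0 // delta_neq0.
by rewrite -!mulnA; congr (_ * _)%N; rewrite mulnA [RHS]mulnC; congr (_ * _)%N; rewrite mulnC.
Qed.

Lemma kappa1_real (U : finType) (A : {set U}) : pow2 U -> (kappa A 1)^* = kappa A 1.
Proof.
move=> HU; apply: fam_invol_real => //; first exact: pow2_K.
by apply: skew_invol; [rewrite mulg1 | move=> x; rewrite perm1].
Qed.

(* The M vectors [w_i], "translate by e_i over A after applying a", have the same Gram matrix
   as the M vectors [u_i] without [a], and <u_i, w_j> agrees with the off-diagonal entries:
   hence the averages of the two families merge as M -> oo. *)
Lemma kappa_mul_invol (U : finType) (A : {set U}) (a z : {perm U}) : pow2 U ->
  (a * a = 1)%g -> (forall x, (a x == x) = (x \notin A)) ->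
  (forall x, (z x \in A) = (x \in A)) -> kappa A (z * a) = kappa A z.
Proof.
move=> HU aa HaA HzA.
have aK x : a (a x) = x by rewrite -permM aa perm1.
have aV : a^-1%g = a by apply/eqP; rewrite eq_invg_mul aa.
have aA x : (a x \in A) = (x \in A).
  by apply: negb_inj; rewrite -!HaA aK eq_sym.
apply/eqP; rewrite eq_sym -subr_eq0; apply/eqP/norm2_le0.
apply: (@archimedean_le0 _ _ (2 * (1 - kappa A 1))) => m.
pose t (i : 'I_m.+1) := ind A (delta i).
have ta i x : t i (a x) = t i x by rewrite /t /ind aA.
have t0 i j x : i != j -> (t i x + t j x == 0) = (x \notin A).
  move=> ij; rewrite /t /ind; case: ifP => xA; last by rewrite addr0 eqxx.
  by rewrite addK_eq0 (inj_eq (@delta_inj _)) (negbTE ij).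
apply: (@two_families_bound _ m (fun i => skew 1 (t i)) (fun i => skew a (t i))
  (skew z (fun=> 0)) (kappa A 1)).
- exact: pow2_K.
- move=> i j ij; rewrite skewV skewM invg1 mulg1; apply: fam_skew_invol => //.
  + by rewrite mulg1.
  + by move=> x; rewrite !perm1.
  + by move=> x; rewrite !perm1 eqxx /= t0.
- move=> i j ij; rewrite skewV skewM mulgV; apply: fam_skew_invol => //.
  + by rewrite mulg1.
  + by move=> x; rewrite !perm1.
  + by move=> x; rewrite permK !perm1 eqxx /= t0.
- move=> i j; rewrite skewV skewM mul1g aV; apply: fam_skew_invol => //.
  + by move=> x; rewrite !perm1 !ta.
  + move=> x; rewrite !perm1 ta HaA; case: (boolP (x \in A)) => //= xA.
    by rewrite /t /ind (negbTE xA) addr0 eqxx.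
- move=> i j; rewrite skewV skewM invg1 mulg1; apply: fam_skew_invol => //.
  + by move=> x; rewrite !perm1 !ta.
  + move=> x; rewrite !perm1 ta HaA; case: (boolP (x \in A)) => //= xA.
    by rewrite /t /ind (negbTE xA) addr0 eqxx.
- move=> i; rewrite skewV skewM invg1 mulg1 -(fam_skew_delta A z i HU); congr V.
  by apply: eq_skew => x; rewrite perm1 add0r /t /ind HzA.
- move=> i; rewrite skewV skewM aV -(fam_skew_delta A _ i HU); congr V.
  by apply: eq_skew => x; rewrite add0r ta /t /ind HzA.
Qed.

(* A transposition [tau] inside [A], extended to [U x {0,1}], is the product of the two
   involutions "flip over A" and "flip over A and apply tau", both with support [A x {0,1}]. *)
Lemma kappa_lift_support (U : finType) (A : {set U}) (s : {perm U}) : pow2 U ->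
  (forall x, x \notin A -> s x = x) ->
  let A' := [set y : U * {ffun unit -> bool} | y.1 \in A] in
  kappa A' (skew s (fun=> 0)) = kappa A' 1.
Proof.
move=> HU sA A'; have HU' := pow2_K unit HU.
have [n Hn] := ubnP (#|U| - nfix s)%N; elim: n s sA Hn => // n IH s sA Hn.
have [->|s1] := eqVneq s 1%g; first by congr kappa; exact: skew1.
have [x xs] : exists x, s x != x.
  apply/existsP; apply: contraNT s1; rewrite negb_exists => /forallP H.
  by apply/eqP/permP => x; rewrite perm1; apply/eqP; rewrite -[_ == _]negbK.
(* [r] fixes [x] besides the fixed points of [s], so the induction on the number of moved points
   advances. *)
pose t := tperm x (s x); pose r := (s * t)%g.
have sE : s = (r * t)%g by rewrite /r -mulgA tperm2 mulg1.
have xA : x \in A by apply: contraNT xs => /sA ->.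
have sxA : s x \in A by apply: contraNT xs => /sA/perm_inj ->.
have tA y : y \notin A -> t y = y.
  by move=> yA; rewrite tpermD //; apply: contraNneq yA => <-.
have rA y : y \notin A -> r y = y by move=> yA; rewrite permM sA // tA.
have Hr : (nfix s < nfix r)%N.
  apply: proper_card; apply/properP; split.
    apply/subsetP => y; rewrite !inE permM => /eqP ys; rewrite ys tpermD //.
      by apply: contraNneq xs => ->; rewrite ys.
    by apply: contraNneq xs => E; apply/eqP/(@perm_inj _ s); rewrite E ys -E.
  by exists x; rewrite !inE ?xs // permM tpermR eqxx.
have Hrn : (#|U| - nfix r < n)%N by have := nfix_le r; lia.
have tt2 : (t * t = 1)%g := tperm2 _ _.
have tmem y : (t y \in A) = (y \in A).
  have [yA|yA] := boolP (y \in A); last by rewrite tA // (negbTE yA).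
  by rewrite /t; case: tpermP.
have rmem y : (r y \in A) = (y \in A).
  have [yA|yA] := boolP (y \in A); last by rewrite rA // (negbTE yA).
  apply/negPn/negP => ryA; have := rA _ ryA => /perm_inj E; by rewrite E yA in ryA.
rewrite -(IH r rA Hrn) sE.
have -> : skew (r * t) (fun=> 0 : {ffun unit -> bool}) =
    (skew r (fun=> 0) * skew 1 (ind A (delta tt)) * skew t (ind A (delta tt)))%g.
  rewrite !skewM mulg1; apply: eq_skew => y.
  by rewrite add0r addKK.
rewrite kappa_mul_invol //.
- rewrite kappa_mul_invol //.
  + by apply: skew_invol; [rewrite mulg1 | move=> y; rewrite perm1].
  + move=> [y b]; rewrite inE skewE xpair_eqE perm1 eqxx -subr_eq0 [b + _]addrC addrK.
    by rewrite ind_eq0 // delta_neq0.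
  + by move=> y; rewrite !inE skewE /= rmem.
- by apply: skew_invol => // y; rewrite /ind tmem.
- move=> [y b]; rewrite inE skewE xpair_eqE -[_ + _ == _]subr_eq0 [b + _]addrC addrK.
  rewrite ind_eq0 ?delta_neq0 //=.
  by case: (boolP (y \in A)) => [|/tA->]; rewrite ?andbF ?eqxx.
- by move=> y; rewrite !inE permM !skewE /= perm1 rmem.
Qed.

Lemma kappa_lift (U : finType) (A : {set U}) (s : {perm U}) : pow2 U ->
  kappa [set y : U * {ffun unit -> bool} | y.1 \in A] (skew s (fun=> 0)) = kappa A s.
Proof.
move=> HU; apply: (@fam_cov _ _ HV _ _ {ffun unit -> bool}
  (fun y => (y.1.1, y.2)) (fun y => y.1.2)).
- exact: pow2_K.
- exact: pow2_ffun pow2_bool.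
- by rewrite !card_prod.
- by move=> [[x a] b] [[x' a'] b'] /= [-> -> ->].
- by move=> [[x a] b]; rewrite !skewE /= /ind inE.
- by move=> [[x a] b]; rewrite !skewE /= addr0.
Qed.

(** [kappa_lift] supplies the extra bit that [kappa_lift_support] needs, and removes it
    afterwards. *)
Lemma kappa_support (U : finType) (A : {set U}) (s : {perm U}) : pow2 U ->
  (forall x, x \notin A -> s x = x) -> kappa A s = kappa A 1.
Proof.
move=> HU sA; rewrite -kappa_lift // kappa_lift_support //.
by rewrite -[RHS]kappa_lift // skew1.
Qed.

(* Compare the conjugates of [s] by "add e_(x,i)" with the translations over the support of [s]:
   quotients of two such conjugates are fibrewise translations without fixed points over it. *)
Lemma fam_kappa (U : finType) (s : {perm U}) : pow2 U ->
  V s = kappa [set x | s x != x] 1.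
Proof.
move=> HU; set A := [set x | s x != x].
have sA x : x \notin A -> s x = x by rewrite inE negbK => /eqP.
have smem x : (s x \in A) = (x \in A) by rewrite !inE (inj_eq (@perm_inj _ s)).
suff E : (V s)^* = kappa A 1 by rewrite -[LHS]conjCK E kappa1_real.
apply/eqP; rewrite -subr_eq0; apply/eqP/norm2_le0.
apply: (@archimedean_le0 _ _ (2 * (1 - kappa A 1))) => m.
(* Bits [(Some x, i)], one for each point [x], serve to conjugate [s]; bits [(None, j)] serve for
   the translations over [A]. *)
pose J : finType := (option U * 'I_m.+1)%type; pose K := {ffun J -> bool}.
pose h (i : 'I_m.+1) (x : U) : K := delta (Some x, i).
pose g i := skew 1 (h i); pose s' := skew s (fun=> 0 : K).
pose w (j : 'I_m.+1) : {perm U * K} := skew 1 (ind A (delta (None, j))).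
have HT : pow2 (U * K)%type by exact: pow2_K.
have uE i : (g i * s' * g i)%g = skew s (fun x => h i x + h i (s x)).
  by rewrite !skewM mulg1 mul1g; apply: eq_skew => x; rewrite addr0.
have gg i : (g i * g i = 1)%g by apply: skew_invol; [rewrite mulg1 | move=> x; rewrite perm1].
have ww i : (w i * w i = 1)%g by apply: skew_invol; [rewrite mulg1 | move=> x; rewrite perm1].
have wV i : ((w i)^-1 = w i)%g by apply/eqP; rewrite eq_invg_mul ww.
have gw i j : (g i * w j = w j * g i)%g.
  by rewrite !skewM; apply: eq_skew => x; rewrite !perm1 addrC.
have Vu i : V (g i * s' * g i)%g = V s.
  rewrite fam_mulC // mulgA gg mul1g; apply: (@fam_cov _ _ HV _ _ K fst snd) => //.
  + exact: pow2_ffun pow2_bool.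
  + by rewrite card_prod.
  + by move=> [? ?] [? ?] [-> ->].
  + by move=> y; rewrite skewE.
  + by move=> y; rewrite skewE addr0.
(* Moving [g i] cyclically and across [w j], with which it commutes, leaves [s' * w j]; its value is
   [kappa A s]. *)
have Huw i j : V (g i * s' * g i * w j)%g = kappa A 1.
  rewrite -!mulgA fam_mulC // -!mulgA -gw (mulgA (g i)) gg mul1g skewM mulg1.
  rewrite -(kappa_support HU sA) -(fam_skew_delta A s ((None, j) : J) HU); congr V.
  by apply: eq_skew => x; rewrite add0r /ind smem.
apply: (@two_families_bound _ m (fun i => g i * s' * g i)%g w 1%g (kappa A 1)) => //.
- move=> i j ij; rewrite !uE skewV skewM mulgV; apply: fam_skew_invol => //.
  + by rewrite mulg1.
  + by move=> x; rewrite !perm1.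
  + move=> x; rewrite perm1 eqxx permK inE negbK /=; have [->|sx] := eqVneq (s x) x.
      by rewrite addKK add0r addKK eqxx.
    (* If [s] moves [x], the bit [(Some x, i)] occurs once among the four translations and
       survives. *)
    apply/negbTE/eqP => /ffunP/(_ (Some x, i)); rewrite !ffunE !xpair_eqE.
    rewrite !eqxx (negbTE ij) !andbF (_ : (Some x == Some (s x)) = false) //.
    by apply/eqP => -[E]; rewrite -E eqxx in sx.
- move=> i j ij; rewrite wV skewM mulg1; apply: fam_skew_invol => //.
  + by rewrite mulg1.
  + by move=> x; rewrite !perm1.
  + move=> x; rewrite !perm1 eqxx /= /ind; case: ifP => xA; last by rewrite addr0 eqxx.
    by rewrite addK_eq0 (inj_eq (@delta_inj _)) xpair_eqE (negbTE ij).
- by move=> i j; rewrite wV.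
- move=> i j; rewrite -[w i]invgK -invMg fam_inv // wV Huw kappa1_real //.
- by move=> i; rewrite mul1g fam_inv // Vu.
- by move=> i; rewrite mul1g wV fam_skew_delta.
Qed.

(** [fam_kappa] replaces [p] by a fibre translation, an involution with the same proportion of fixed
    points, and [fam_invol] compares involutions. *)
Lemma fam_nfix (T T' : finType) (p : {perm T}) (p' : {perm T'}) : pow2 T -> pow2 T' ->
  (p' * p' = 1)%g -> (nfix p * #|T'| = nfix p' * #|T|)%N -> V p = V p'.
Proof.
move=> HT HT' pp' E; rewrite fam_kappa //; apply: fam_invol => //.
- exact: pow2_K.
- by apply: skew_invol; [rewrite mulg1 | move=> x; rewrite perm1].
rewrite nfix_skew card_prod mulnAC mulnA -E; congr (_ * _ * _)%N; apply: eq_card => x.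
by rewrite !inE perm1 eqxx ind_eq0 ?delta_neq0 // inE negbK.
Qed.

End FixedPoints.

(** * Nonnegativity of differences *)

Section Differences.

Variables (R : realType) (V : forall T : finType, {perm T} -> R[i]) (HV : charfam V).
Local Notation C := R[i].
Variables (n j b : nat) (jb : (j + b = 2 ^ n)%N) (f : nat -> C).
Hypothesis Hf : forall (T : finType) (p : {perm T}) i, pow2 T -> (p * p = 1)%g ->
  (nfix p * 2 ^ n = i * #|T|)%N -> V p = f i.

Local Notation B := {ffun 'I_j -> bool}.

Let nzero (D : B) : nat := #|[set l | ~~ D l]|.
Let sgn (D : B) : C := \prod_l (-1) ^+ D l.

Let sgnD D D' : sgn (D + D') = sgn D * sgn D'.
Proof.
rewrite /sgn -big_split; apply: eq_bigr => l _; rewrite ffunE; exact: signr_addb.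
Qed.

Let sgn_sq D : sgn D * sgn D = 1.
Proof. by rewrite -sgnD addKK /sgn big1 // => l _; rewrite ffunE. Qed.

Let sgn_conj D : (sgn D)^* = sgn D.
Proof.
by rewrite /sgn rmorph_prod; apply: eq_bigr => l _; rewrite rmorphXn rmorphN1.
Qed.

(* Test vector: signs on the group {0,1}^j acting on [j] blocks, tensored with the sum of [M]
   translations on the remaining [b] blocks, which kills them as M -> oo. *)
Lemma alternating_sum_bound m :
  0 <= \sum_D sgn D * f (nzero D + b)%N + m.+1%:R * \sum_D sgn D * f (nzero D).
Proof.
pose M := m.+2; pose J : finType := option 'I_M; pose U : finType := ('I_j + 'I_b)%type.
have HU : pow2 U by exists n; rewrite card_sum !card_ord.
(* The quotient of two such translations fixes everything over point [l] of the first [j] when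
   [D l = D' l], and over the other [b] points only when [i = i']. As [M = m.+2], each [i] has
   [m.+1] partners. *)
pose t (D : B) (i : 'I_M) (x : U) : {ffun J -> bool} :=
  match x with inl l => if D l then delta None else 0 | inr _ => delta (Some i) end.
have tv (D : B) (i : 'I_M) (D' : B) (i' : 'I_M) : V (skew 1 (t D i) * (skew 1 (t D' i'))^-1)%g =
    f (nzero (D + D')%R + (if i == i' then b else 0))%N.
  rewrite skewV skewM invg1 mulg1; apply: Hf; first exact: pow2_K.
    by apply: skew_invol; [rewrite mulg1 | move=> x; rewrite !perm1].
  rewrite nfix_skew card_prod card_sum !card_ord jb mulnAC mulnA; congr (_ * _ * _)%N.
  rewrite -sum1_card big_mkcond big_sumType /=; congr (_ + _)%N.
    rewrite /nzero -sum1_card [RHS]big_mkcond; apply: eq_bigr => l _.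
    rewrite !inE !perm1 eqxx ffunE /= -[D l + D' l]/(D l (+) D' l).
    case: (D l); case: (D' l) => /=; rewrite ?addKK ?addr0 ?add0r ?eqxx //;
    by rewrite (negbTE (delta_neq0 _)).
  rewrite (eq_bigr (fun=> (i == i') : nat)).
    by rewrite big_const_ord iter_addn_0; case: (i == i'); rewrite ?mul1n ?mul0n.
  move=> l _; rewrite !inE !perm1 eqxx /= addK_eq0 (inj_eq (@delta_inj _)).
  by rewrite -[Some i == Some i']/(i == i'); case: (i == i').
have := fam_pd HV (fun x : B * 'I_M => sgn x.1) (fun x => skew 1 (t x.1 x.2)) (pow2_K J HU).
rewrite -(pair_bigA _ (fun D i => \sum_y (sgn D)^* * sgn y.1 *
   V (skew 1 (t D i) * (skew 1 (t y.1 y.2))^-1)%g)) /=.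
rewrite (_ : \sum_D _ = \sum_(D : B) M%:R * (\sum_D sgn D * f (nzero D + b)%N +
  m.+1%:R * \sum_D sgn D * f (nzero D))).
  rewrite sumr_const -[X in 0 <= X]mulr_natl pmulr_rge0 ?pmulr_rge0 ?ltr0n //.
  by rewrite card_ffun card_bool expn_gt0.
apply: eq_bigr => D _.
rewrite -[M in M%:R]card_ord -sum1_card natr_sum mulr_suml; apply: eq_bigr => i _.
rewrite mul1r -(pair_bigA _ (fun D' i' => (sgn D)^* * sgn D' *
   V (skew 1 (t D i) * (skew 1 (t D' i'))^-1)%g)) /=.
(* The kernel depends on [D] and [D'] only through their sum, so every row has the same total. *)
rewrite (reindex_inj (addrI D)) /= mulr_sumr -big_split /=; apply: eq_bigr => D' _.
have -> : (sgn D)^* * sgn (D + D') = sgn D'.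
  by rewrite sgn_conj sgnD mulrA sgn_sq mul1r.
rewrite -mulr_sumr mulrCA -mulrDr; congr (_ * _).
under eq_bigr => i' _ do rewrite tv addrA addKK add0r.
rewrite (bigD1 i) //= eqxx; congr (_ + _).
rewrite (eq_bigr (fun=> f (nzero D'))); last first.
  by move=> i' /negbTE; rewrite eq_sym => ->; rewrite addn0.
by rewrite sumr_const cardC1 card_ord mulr_natl.
Qed.

(** Letting [m] grow in [alternating_sum_bound] leaves the signed sum over {0,1}^j, which is
    regrouped by the weight [d] of the vector. *)
Lemma alternating_sum_ge0 : 0 <= \sum_(d < j.+1) (-1) ^+ d * 'C(j, d)%:R * f (j - d)%N.
Proof.
rewrite (_ : \sum_(d < _) _ = \sum_D sgn D * f (nzero D)).
  rewrite -oppr_le0; apply: (@archimedean_le0 _ _ (\sum_D sgn D * f (nzero D + b)%N)) => m.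
  by rewrite mulrN -subr_ge0 opprK; exact: alternating_sum_bound.
rewrite (reindex_onto (fun A : {set 'I_j} => [ffun l => l \in A]) (fun D => [set l | D l])) /=;
  last by move=> D _; apply/ffunP => l; rewrite ffunE inE.
rewrite [RHS](eq_bigl xpredT); last first.
  move=> A; rewrite /= (_ : [set l | _] = A) ?eqxx //.
  by apply/setP => l; rewrite inE ffunE.
rewrite [RHS](eq_bigr (fun A : {set 'I_j} => (-1) ^+ #|A| * f (j - #|A|)%N)); last first.
  move=> A _; congr (_ * f _).
    rewrite /sgn prodrXr; congr (_ ^+ _).
    by rewrite -sum1_card [RHS]big_mkcond; apply: eq_bigr => l _; rewrite ffunE; case: (l \in A).
  rewrite /nzero (_ : [set l | _] = ~: A); last by apply/setP => l; rewrite !inE ffunE.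
  by rewrite cardsCs setCK card_ord.
rewrite [RHS](partition_big (fun A : {set 'I_j} => inord #|A| : 'I_j.+1) xpredT) //=.
apply: eq_bigr => d _.
have Acard (A : {set 'I_j}) : (inord #|A| == d) = (#|A| == d).
  have Aj : (#|A| < j.+1)%N by rewrite ltnS -[X in (_ <= X)%N]card_ord max_card.
  by rewrite -val_eqE /= inordK.
rewrite (eq_bigr (fun=> (-1) ^+ d * f (j - d)%N)); last first.
  by move=> A; rewrite Acard => /eqP ->.
rewrite (eq_bigl (mem [set A : {set 'I_j} | #|A| == d])); last first.
  by move=> A; rewrite Acard !inE.
by rewrite sumr_const card_draws card_ord -[RHS]mulr_natl mulrA; congr (_ * _); rewrite mulrC.
Qed.

End Differences.

(** * Multiplicative functions with nonnegative differences *)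

Section Newton.

Variable R : comPzRingType.
Implicit Types (f h : nat -> R).

Lemma pascal_sum h i :
  \sum_(j < i.+2) 'C(i.+1, j)%:R * h j =
  \sum_(j < i.+1) 'C(i, j)%:R * h j + \sum_(j < i.+1) 'C(i, j)%:R * h j.+1.
Proof.
rewrite big_ord_recl bin0; under eq_bigr => j _ do rewrite lift0 binS natrD mulrDl.
rewrite big_split /= addrA; congr (_ + _).
rewrite big_ord_recr /= bin_small // mul0r addr0 [RHS]big_ord_recl /= bin0; congr (_ + _).
Qed.

Definition fdiff f : nat -> R := fun x => f x.+1 - f x.

Definition alt_sum f j : R := \sum_(d < j.+1) (-1) ^+ d * 'C(j, d)%:R * f (j - d)%N.

Lemma iter_fdiff f j x :
  iter j fdiff f x = \sum_(d < j.+1) 'C(j, d)%:R * ((-1) ^+ d * f (x + j - d)%N).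
Proof.
elim: j x => [|j IH] x; first by rewrite big_ord1 /= bin0 !mul1r addn0 subn0.
rewrite iterS /fdiff !IH (pascal_sum (fun d => (-1) ^+ d * f (x + j.+1 - d)%N)).
rewrite addSnnS -sumrN; congr (_ + _); apply: eq_bigr => d _.
by rewrite addnS subSS exprS mulN1r mulNr mulrN.
Qed.

Lemma iter_fdiff0 f j : iter j fdiff f 0%N = alt_sum f j.
Proof. by rewrite iter_fdiff; apply: eq_bigr => d _; rewrite add0n mulrA [_%:R * _]mulrC. Qed.

Lemma newton f x i : f (x + i)%N = \sum_(j < i.+1) 'C(i, j)%:R * iter j fdiff f x.
Proof.
elim: i x f => [|i IH] x f; first by rewrite big_ord1 bin0 mul1r addn0.
rewrite (pascal_sum (fun j => iter j fdiff f x)) -IH.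
under eq_bigr => j _ do rewrite iterSr.
by rewrite -(IH x (fdiff f)) /fdiff addrC subrK addnS.
Qed.

(** Padding to a common length [N] lets values at different arguments be compared term by term. *)
Lemma newton0 f i N : (i <= N)%N -> f i = \sum_(j < N.+1) 'C(i, j)%:R * alt_sum f j.
Proof.
move=> iN; rewrite -[i in f i]add0n newton.
rewrite -(big_mkord xpredT (fun j => 'C(i, j)%:R * alt_sum f j)).
rewrite (@big_cat_nat _ _ _ i.+1) //= [X in _ + X]big_nat_cond [X in _ + X]big1 ?addr0 ?big_mkord.
  by apply: eq_bigr => j _; rewrite iter_fdiff0.
by move=> j /andP[/andP[ij _] _]; rewrite bin_small // mul0r.
Qed.

End Newton.

Lemma leq_expn_base a b m : (a <= b -> a ^ m <= b ^ m)%N.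
Proof. by case: m => // m ab; rewrite leq_exp2r. Qed.

Lemma ffact_ge n j : ((n - j) ^ j <= n ^_ j)%N.
Proof.
elim: j n => [|j IH] n; first by rewrite expn0 ffactn0.
rewrite ffactnS expnS leq_mul ?leq_subr // subnS -subn1 subnAC subn1; exact: IH.
Qed.

Section BinomialPolynomials.

Variable R : numFieldType.

Fixpoint binpoly (j : nat) : {poly R} :=
  if j is j'.+1 then (j'.+1%:R)^-1 *: (binpoly j' * ('X - (j'%:R)%:P)) else 1.

Lemma binpolyE j i : (binpoly j).[i%:R] = 'C(i, j)%:R.
Proof.
elim: j => [|j IH] /=; first by rewrite hornerE bin0.
rewrite hornerZ hornerM hornerXsubC IH.
apply: (@mulfI _ j.+1%:R); first by rewrite pnatr_eq0.
rewrite mulrA divff ?pnatr_eq0 // mul1r -natrM mul_bin_left natrM mulrC.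
have [ji|ij] := leqP j i; first by rewrite natrB.
by rewrite bin_small // !mulr0.
Qed.

Lemma poly_nat_eq0 (p : {poly R}) : (forall i : nat, p.[i%:R] = 0) -> p = 0.
Proof.
move=> H; apply: (@roots_geq_poly_eq0 _ p [seq i%:R | i <- iota 0 (size p)]).
- by apply/allP => x /mapP[i _ ->]; rewrite /root H.
- by rewrite map_inj_uniq ?iota_uniq // => i j /eqP; rewrite eqr_nat => /eqP.
- by rewrite size_map size_iota.
Qed.

(* [P(2x) = c P(x)] forces [P] to be a monomial. *)
Lemma poly_homogeneous (p : {poly R}) (c : R) :
  p.[1] = 1 -> (forall i : nat, p.[(2 * i)%:R] = c * p.[i%:R]) ->
  exists k, forall i : nat, p.[i%:R] = i%:R ^+ k.
Proof.
move=> p1 Hp; pose q := \poly_(i < size p) (2 ^+ i * p`_i) - c *: p.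
have q0 : q = 0.
  apply: poly_nat_eq0 => i; rewrite hornerD hornerN hornerZ -Hp horner_poly horner_coef.
  apply/eqP; rewrite subr_eq0; apply/eqP; apply: eq_bigr => j _.
  by rewrite natrM exprMn mulrA [2 ^+ j * _]mulrC.
have Hc i : 2 ^+ i * p`_i = c * p`_i.
  have /(congr1 (fun r : {poly R} => r`_i)) := q0.
  rewrite coefB coefZ coef_poly coef0; case: ltnP => Hi; last by rewrite nth_default // !mulr0.
  by move/eqP; rewrite subr_eq0 => /eqP.
have pn0 : p != 0 by apply: contra_eqN p1 => /eqP->; rewrite horner0 eq_sym oner_eq0.
pose k := (size p).-1; exists k.
have pk0 : p`_k != 0 by rewrite -lead_coefE lead_coef_eq0.
have ck : c = 2 ^+ k by apply/esym/(mulIf pk0).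
have pE : p = p`_k *: 'X^k.
  apply/polyP => i; rewrite coefZ coefXn; have [->|ik] := eqVneq i k; first by rewrite mulr1.
  rewrite mulr0; apply/eqP; apply: contra_neqT ik => pi0.
  have /eqP := mulIf pi0 (Hc i); rewrite ck -!natrX eqr_nat eqn_exp2l // => /eqP; exact.
have pk1 : p`_k = 1 by move: p1; rewrite {1}pE hornerZ hornerXn expr1n mulr1.
by move=> i; rewrite pE hornerZ hornerXn pk1 mul1r.
Qed.

End BinomialPolynomials.

(** * Multiplicative functions of dyadic fractions; [G n i] is the value at [i / 2 ^ n] *)

Section Classification.

Variables (R : realType) (G : nat -> nat -> R).
Hypothesis G_alt : forall n j, (j <= 2 ^ n)%N -> 0 <= alt_sum (G n) j.
Hypothesis G_mul : forall n m i k, (i <= 2 ^ n)%N -> (k <= 2 ^ m)%N ->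
  G (n + m) (i * k) = G n i * G m k.
Hypothesis G_one : forall n, G n (2 ^ n) = 1.

Let G_ge0 n i : (i <= 2 ^ n)%N -> 0 <= G n i.
Proof.
move=> Hi; rewrite (newton0 _ Hi); apply: sumr_ge0 => j _; apply: mulr_ge0; first exact: ler0n.
by apply: G_alt; rewrite -ltnS.
Qed.

Let G_mono n i k : (i <= k)%N -> (k <= 2 ^ n)%N -> G n i <= G n k.
Proof.
move=> ik Hk; rewrite (newton0 _ (leq_trans ik Hk)) (newton0 _ Hk).
apply: ler_sum => j _; apply: ler_wpM2r; first by apply: G_alt; rewrite -ltnS.
by rewrite ler_nat leq_bin2l.
Qed.

Let q := G 1 1.

Let G_n1 n : G n 1 = q ^+ n.
Proof.
elim: n => [|n IH]; first exact: (G_one 0).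
by rewrite -addn1 -{2}[1%N]mul1n G_mul ?expn_gt0 // IH addn1 exprSr.
Qed.

Let G_exp n i m : (i <= 2 ^ n)%N -> G (n * m) (i ^ m) = G n i ^+ m.
Proof.
move=> Hi; elim: m => [|m IH]; first by rewrite muln0 expn0 (G_one 0).
by rewrite mulnS expnS G_mul ?IH ?exprS // expnM leq_expn_base.
Qed.

Let bernoulli (x : R) n : 0 <= x -> 1 + n%:R * x <= (1 + x) ^+ n.
Proof.
move=> x0; elim: n => [|n IH]; first by rewrite mul0r addr0 expr0.
rewrite exprS; apply: le_trans (ler_wpM2l _ IH); last lra.
have h : 0 <= n%:R * x * x by rewrite !mulr_ge0 ?ler0n.
by rewrite -natr1; lra.
Qed.

Let archi (x y : R) : (forall m : nat, m%:R * x <= y) -> x <= 0.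
Proof.
move=> H; rewrite leNgt; apply/negP => x0.
have y0 : 0 <= y / x by rewrite divr_ge0 ?(ltW x0) //; have := H 0%N; rewrite mul0r.
have := archi_boundP y0; rewrite ltr_pdivrMr // => h.
by have := lt_le_trans h (H _); rewrite ltxx.
Qed.

(** By monotonicity a zero at 1/2 kills all fractions up to 1/2; a fraction below 1 has a power at
    most 1/2, and multiplicativity carries the zero back. *)
Let classification_zero : q = 0 -> forall n i, (i < 2 ^ n)%N -> G n i = 0.
Proof.
move=> q0 n i Hi.
have small m k : (k.*2 <= 2 ^ m)%N -> G m k = 0.
  case: m => [|m] Hk.
    have -> : k = 0%N by move: Hk; rewrite expn0; lia.
    have h0 : G 1 0 = 0.
      by apply/eqP; rewrite eq_le G_ge0 // -q0 /q G_mono.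
    have := G_mul (n := 0) (m := 1) (i := 0) (k := 0) isT isT.
    have := G_mul (n := 0) (m := 1) (i := 0) (k := 2) isT isT.
    by rewrite mul0n h0 (G_one 1) mulr1.
  have Hk' : (k <= 2 ^ m)%N by move: Hk; rewrite expnS; lia.
  apply/eqP; rewrite eq_le G_ge0 ?andbT; last by rewrite expnS; lia.
  apply: le_trans (G_mono (n := m.+1) Hk' _) _; first by rewrite expnS; lia.
  by rewrite -[(2 ^ m)%N]mul1n -[m.+1]add1n G_mul // G_one mulr1 -/q q0.
have [m Hm] : exists m, ((i ^ m.+1).*2 <= 2 ^ (n * m.+1))%N.
  have [->|i0] := posnP i; first by exists 0%N; rewrite expn1 double0.
  (* For [m > 1/x], Bernoulli's inequality gives [(2 ^ n / i) ^ m.+1 >= 2]. *)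
  pose x : R := (2 ^ n)%:R / i%:R - 1.
  have x0 : 0 < x.
    by rewrite subr_gt0 ltr_pdivlMr ?ltr0n // mul1r ltr_nat.
  pose m := Num.Def.archi_bound x^-1; exists m.
  have := archi_boundP (ltW (_ : 0 < x^-1)); rewrite invr_gt0 => /(_ x0) Hm.
  have := bernoulli m.+1 (ltW x0); rewrite (_ : 1 + x = (2 ^ n)%:R / i%:R); last by rewrite /x; ring.
  rewrite exprMn exprVn ler_pdivlMr ?exprn_gt0 ?ltr0n // -!natrX => K.
  rewrite -(ler_nat R) expnM -muln2 natrM mulrC; apply: le_trans K.
  apply: ler_wpM2r; first exact: ler0n.
  have : 1 <= m%:R * x by rewrite -ler_pdivrMr // mul1r ltW.
  by rewrite -natr1; lra.
have /eqP : G n i ^+ m.+1 = 0 by rewrite -G_exp ?(ltnW Hi) // small.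
by rewrite expf_eq0 /= => /eqP.
Qed.

Section Positive.

Hypothesis q0 : 0 < q.

(** [G n i / q ^ n] does not depend on the level [n]; level [i] is admissible because
    [i <= 2 ^ i]. *)
Let g i : R := G i i / q ^+ i.

(** [G n i * q ^ i] and [G i i * q ^ n] are both the value of [G (n + i)] at [i]. *)
Let GE n i : (i <= 2 ^ n)%N -> G n i = q ^+ n * g i.
Proof.
move=> Hi; have ii : (i <= 2 ^ i)%N by rewrite ltnW // ltn_expl.
have E1 := G_mul (k := 1) Hi (expn_gt0 2 i : (1 <= 2 ^ i)%N).
have E2 := G_mul (k := 1) ii (expn_gt0 2 n : (1 <= 2 ^ n)%N).
rewrite !muln1 !G_n1 in E1 E2; rewrite addnC E2 in E1.
by rewrite /g mulrA [q ^+ n * _]mulrC E1 mulfK // expf_neq0 // gt_eqF.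
Qed.

Let g_alt j : 0 <= alt_sum g j.
Proof.
have jj : (j <= 2 ^ j)%N by rewrite ltnW // ltn_expl.
have := G_alt jj; rewrite (_ : alt_sum (G j) j = q ^+ j * alt_sum g j).
  by rewrite pmulr_rge0 // exprn_gt0.
rewrite /alt_sum mulr_sumr; apply: eq_bigr => d _; rewrite GE; first by rewrite mulrCA.
by apply: leq_trans jj; exact: leq_subr.
Qed.

Let g_pow2 m : g (2 ^ m)%N = q ^- m.
Proof.
have := G_one m; rewrite GE // => /(canRL (mulKf _)); rewrite mulr1; apply.
by rewrite expf_neq0 // gt_eqF.
Qed.

(* [g] grows polynomially along powers of 2, which bounds the order of its differences. *)
Let g_alt_eq0 j : 1 < 2 ^+ j * q -> alt_sum g j = 0.
Proof.
move=> Hj; apply/eqP; rewrite eq_le g_alt andbT.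
pose e := 2 ^+ j * q - 1; have e0 : 0 < e by rewrite subr_gt0.
(* [c] collects the factors of [2 ^ ((m + j) * j) * q ^ M] free of [m]; the rest, [(2 ^ j * q) ^ m],
   grows at least like [m * e]. *)
pose c := 2 ^+ (j * j) * q ^+ j.+1 : R.
have c0 : 0 < c by rewrite mulr_gt0 // exprn_gt0.
suff : alt_sum g j * c * e <= 0 by rewrite pmulr_lle0 // pmulr_lle0.
apply: (@archi _ (j`!)%:R) => m.
pose M := (m + j.+1)%N.
have jM : (j.*2 <= 2 ^ M)%N.
  have : (j < 2 ^ j)%N by exact: ltn_expl.
  have : (2 ^ j.+1 <= 2 ^ M)%N by rewrite leq_exp2l // leq_addl.
  by rewrite expnS; lia.
have B1 : 'C(2 ^ M, j)%:R * alt_sum g j <= q ^- M.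
  have jM' : (j < (2 ^ M).+1)%N by lia.
  rewrite -g_pow2 (newton0 g (leqnn (2 ^ M))) (bigD1 (Ordinal jM')) //= lerDl.
  by apply: sumr_ge0 => i _; rewrite mulr_ge0.
have B2 : ((2 ^ (m + j)) ^ j <= 'C(2 ^ M, j) * j`!)%N.
  rewrite bin_ffact; apply: leq_trans (ffact_ge _ _).
  apply: leq_expn_base.
  by move: jM; rewrite /M addnS expnS; lia.
have B3 : (2 ^+ ((m + j) * j) : R) <= 'C(2 ^ M, j)%:R * (j`!)%:R.
  by rewrite -natrM -natrX ler_nat expnM.
have B4 : 2 ^+ ((m + j) * j) * alt_sum g j <= (j`!)%:R * q ^- M.
  apply: le_trans (ler_wpM2r (g_alt j) B3) _.
  by rewrite mulrAC mulrC; apply: ler_wpM2l => //; exact: ler0n.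
have B5 : (1 + e) ^+ m * (alt_sum g j * c) <= (j`!)%:R.
  rewrite /e addrC subrK -(@ler_pM2r _ (q ^- M)) ?invr_gt0 ?exprn_gt0 //.
  apply: le_trans B4; rewrite le_eqVlt; apply/orP; left; apply/eqP.
  rewrite /c /M exprMn mulnDl -exprM [(j * m)%N]mulnC !exprD; field.
  by rewrite !expf_neq0 // gt_eqF.
apply: le_trans B5; rewrite [_ * e]mulrC mulrA; apply: ler_wpM2r.
  by rewrite mulr_ge0 // ltW.
by apply: le_trans (bernoulli m (ltW e0)); rewrite lerDr.
Qed.

Let g_mul2 i : g (2 * i)%N = g 2 * g i.
Proof.
have ii : (i <= 2 ^ i)%N by rewrite ltnW // ltn_expl.
have h2 : (2 <= 2 ^ 1)%N by [].
have := G_mul h2 ii; rewrite !GE //; last first.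
  by rewrite expnD leq_mul.
rewrite exprD [RHS]mulrACA; apply: mulfI.
by rewrite mulf_neq0 // expf_neq0 // gt_eqF.
Qed.

Lemma power_classification_pos : exists k, forall n i, (i <= 2 ^ n)%N -> G n i = (i%:R / 2 ^+ n) ^+ k.
Proof.
have [N HN] : exists N, forall j, (N <= j)%N -> alt_sum g j = 0.
  (* Beyond [1/q] the condition of [g_alt_eq0] holds because [j < 2 ^ j]. *)
  exists (Num.Def.archi_bound q^-1) => j Hj; apply: g_alt_eq0.
  rewrite -ltr_pdivrMr // mul1r.
  have := archi_boundP (ltW (_ : 0 < q^-1)); rewrite invr_gt0 => /(_ q0) h.
  apply: lt_trans h _; apply: le_lt_trans (_ : j%:R < _); first by rewrite ler_nat.
  by rewrite -natrX ltr_nat ltn_expl.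
(* The Newton series of [g] terminates, so [g] is a polynomial on the integers. *)
pose p := \sum_(j < N) alt_sum g j *: binpoly R j.
have pE (i : nat) : p.[i%:R] = g i.
  rewrite horner_sum (@newton0 _ g i (maxn i N)) ?leq_maxl //.
  rewrite -(big_mkord xpredT (fun j => 'C(i, j)%:R * alt_sum g j)).
  rewrite (@big_cat_nat _ _ _ N) //=; last by rewrite leqW // leq_maxr.
  rewrite [X in _ + X]big_nat_cond [X in _ + X]big1 ?addr0 ?big_mkord.
    by apply: eq_bigr => j _; rewrite hornerZ binpolyE mulrC.
  by move=> j /andP[/andP[Nj _] _]; rewrite HN // mulr0.
have [|i|k Hk] := @poly_homogeneous _ p (g 2).
- by rewrite -[1]/(1%:R) pE; have := g_pow2 0; rewrite expn0 expr0 invr1.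
- by rewrite !pE g_mul2.
exists k => n i Hi; rewrite GE // -pE Hk expr_div_n [LHS]mulrC; congr (_ * _).
have := g_pow2 n; rewrite -pE Hk => /(congr1 GRing.inv); rewrite invrK => <-.
by rewrite natrX.
Qed.

End Positive.

Lemma power_classification :
  exists a, forall n i, (i <= 2 ^ n)%N -> G n i = powinf (i%:R / 2 ^+ n) a.
Proof.
have [q0|q0] := eqVneq q 0; last first.
  have [|k Hk] := power_classification_pos; first by rewrite lt_neqAle eq_sym q0 G_ge0.
  by exists (Some k).
exists None => n i Hi /=; have pn0 : (2 ^+ n : R) != 0 by rewrite expf_neq0 // pnatr_eq0.
case: eqP => [/divr1_eq/eqP|H].
  by rewrite -natrX eqr_nat => /eqP->.
apply: classification_zero => //; rewrite ltn_neqAle Hi andbT; apply/eqP => E.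
by apply: H; rewrite E natrX divff.
Qed.

End Classification.

(** * Indecomposable characters *)

Section Multiplicativity.

Variables (R : realType) (V : forall T : finType, {perm T} -> R[i]) (HV : charfam V).
Local Notation C := R[i].
Variables (U : finType) (h : {perm U}).
Hypotheses (HU : pow2 U) (hh : (h * h = 1)%g).

Let hV : (h^-1 = h)%g.
Proof. by apply/eqP; rewrite eq_invg_mul hh. Qed.

(** Cauchy-Schwarz against [e_h - V h e_1], of squared norm [1 - V h ^ 2]. It bounds [V h] and
    settles the extreme cases 1 and -1. *)
Lemma fam_invol_CS (T : finType) (p : {perm T}) : pow2 T ->
  `|V (prod_perm p h) - V h * V p| ^+ 2 <= 1 - V h ^+ 2.
Proof.
move=> HT; have HTU := pow2_prod HT HU.
have := @fam_CS _ _ HV _ _ (fun b : bool => if b then 1 else - V h)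
  (fun b => prod_perm 1 (if b then h else 1%g)) (prod_perm p 1) HTU.
rewrite !big_bool /= !prod_permV invg1 hV !prod_permM !invg1 !mulg1 !mul1g hh.
rewrite prod_perm1 fam_one // !fam_prod_1l // fam_prod_1r // rmorphN /= fam_invol_real //.
rewrite conjC1 !mul1r !mulr1 mulNr => H; apply: le_trans H _.
by rewrite le_eqVlt; apply/orP; left; apply/eqP; ring.
Qed.

(** For [e] equal to 1 or -1, this cuts [V] down by the projection [(1 + e h) / 2] onto an
    eigenspace of [h] in independent coordinates, and normalises. *)
Definition twist_fam (e : C) : forall T : finType, {perm T} -> C :=
  fun T p => (V p + e * V (prod_perm p h)) / (1 + e * V h).

(* Positivity: [h] commutes with [p x 1] and [h * h = 1], so that
   [V p + e * V (p x h)] is half the Gram kernel of the vectors [(1 + e h) g]. *)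
Lemma twist_famP (e : C) : e * e = 1 -> e^* = e -> 0 < 1 + e * V h -> charfam (twist_fam e).
Proof.
move=> ee eR c0; split.
- move=> T T' W f r p p' HT HW HT' finj Hf Hr; rewrite /twist_fam.
  rewrite (fam_cov HV HT HW HT' finj Hf Hr).
  congr ((_ + _ * _) / _).
  apply: (@fam_cov _ _ HV _ _ W (fun y => (f y.1, y.2)) (fun y => r y.1)) => //.
  + exact: pow2_prod.
  + by rewrite !card_prod HT' mulnAC.
  + move=> [x a] [x' a'] /= [E1 -> E2]; congr (_, _); apply: finj; by rewrite E1 E2.
  + by move=> y; rewrite !prod_permE /= Hf.
  + by move=> y; rewrite !prod_permE /= Hr.
- move=> T I c g HT; have HTU := pow2_prod HT HU.
  have := fam_pd HV (fun x : I * bool => c x.1 * (if x.2 then e else 1))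
    (fun x => prod_perm (g x.1) (if x.2 then h else 1%g)) HTU.
  rewrite -(pair_bigA _ (fun i b => \sum_y (c i * (if b then e else 1))^* *
    (c y.1 * (if y.2 then e else 1)) * V (prod_perm (g i) (if b then h else 1%g) *
      (prod_perm (g y.1) (if y.2 then h else 1%g))^-1)%g)) /=.
  rewrite (_ : \sum_i \sum_b _ = 2 * (1 + e * V h) *
     \sum_i \sum_j (c i)^* * c j * twist_fam e (g i * (g j)^-1)%g).
    by rewrite pmulr_rge0 // mulr_gt0 // ltr0n.
  rewrite mulr_sumr; apply: eq_bigr => i _; rewrite big_bool /=.
  rewrite -!(pair_bigA _ (fun j b => (c i * _)^* * (c j * (if b then e else 1)) *
      V (prod_perm (g i) _ * (prod_perm (g j) (if b then h else 1%g))^-1)%g)) /=.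
  rewrite -big_split mulr_sumr; apply: eq_bigr => j _; rewrite !big_bool /=.
  rewrite !prod_permV hV invg1 !prod_permM !mulg1 !mul1g hh.
  rewrite fam_prod_1r // /twist_fam !rmorphM rmorph1 /= eR !mulr1.
  have -> : 2 * (1 + e * V h) * ((c i)^* * c j * ((V (g i * (g j)^-1)%g +
      e * V (prod_perm (g i * (g j)^-1)%g h)) / (1 + e * V h))) =
     2 * ((c i)^* * c j * (V (g i * (g j)^-1)%g + e * V (prod_perm (g i * (g j)^-1)%g h))).
    by field; rewrite gt_eqF.
  rewrite (_ : (c i)^* * e * (c j * e) = (c i)^* * c j); last by rewrite mulrACA ee mulr1.
  ring.
- move=> T HT; rewrite /twist_fam fam_one // fam_prod_1l // divff //.
  by rewrite gt_eqF.
Qed.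

Lemma indecomposable_mul (chi : (X -> X) -> C) (T : finType) (p : {perm T}) :
  (forall s, chi (s2act s) = V (sperm s)) -> is_indecomposable_character chi -> pow2 T ->
  V (prod_perm p h) = V p * V h.
Proof.
move=> Hchi [_ Hind] HT.
have cR : (V h)^* = V h by exact: fam_invol_real.
have [r Er] : exists r : R, V h = r%:C%C.
  by exists (complex.Re (V h)); rewrite RRe_real // CrealE cR.
have c2 : V h ^+ 2 <= 1.
  rewrite -subr_ge0; apply: le_trans (fam_invol_CS p HT); exact: exprn_ge0.
have r2 : r ^+ 2 <= 1 by move: c2; rewrite Er -rmorphXn -[1]/(1%:C%C) lecR.
(* When [V h] is 1 or -1 one twist has denominator 0, but the Cauchy-Schwarz bound gives the product
   formula directly. *)
have [r1|r1] := eqVneq (r ^+ 2) 1.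
  have E0 : 1 - V h ^+ 2 = 0 by rewrite Er -rmorphXn /= r1 rmorph1 subrr.
  have := fam_invol_CS p HT; rewrite E0 => /norm2_le0/eqP.
  by rewrite subr_eq0 mulrC => /eqP.
have rlt : r ^+ 2 < 1 by rewrite lt_neqAle r1.
have rp : 0 < 1 + r by nra.
have rm : 0 < 1 - r by nra.
have Hp : 0 < 1 + 1 * V h by rewrite mul1r Er -[1]/(1%:C%C) -rmorphD ltcR.
have Hm : 0 < 1 + (-1) * V h by rewrite mulN1r Er -[1]/(1%:C%C) -rmorphB ltcR.
have HW1 := twist_famP (mulr1 1) (conjC1 _) Hp.
have HW2 : charfam (twist_fam (-1)) by apply: twist_famP; rewrite ?mulrNN ?mulr1 ?rmorphN1.
have [chi1 Hchi1 E1] := char_of_fam HW1; have [chi2 Hchi2 E2] := char_of_fam HW2.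
(* The weights are half the two denominators, so the terms with [h] cancel. *)
have Hsum (S : finType) (s : {perm S}) :
    V s = ((1 + r) / 2)%:C%C * twist_fam 1 s + (1 - (1 + r) / 2)%:C%C * twist_fam (-1) s.
  have -> : 1 - (1 + r) / 2 = (1 - r) / 2 by field.
  rewrite /twist_fam !mul1r !mulN1r Er.
  have -> : ((1 + r) / 2)%:C%C = (1 + r%:C%C) / 2.
    by rewrite rmorphM rmorphD rmorph1 fmorphV rmorph_nat.
  have -> : ((1 - r) / 2)%:C%C = (1 - r%:C%C) / 2.
    by rewrite rmorphM rmorphB rmorph1 fmorphV rmorph_nat.
  move: Hp Hm; rewrite mul1r mulN1r Er; move: (V s) (V (prod_perm s h)) (r%:C%C) => x y c Hp Hm.
  by field; rewrite !gt_eqF.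
have Heq s : twist_fam 1 (sperm s) = twist_fam (-1) (sperm s).
  apply: contrapT => Hne; apply: Hind; exists ((1 + r) / 2), chi1, chi2; split => //.
  - by apply/andP; split; lra.
  - by move=> g; rewrite Hchi E1 E2.
  - by exists s; rewrite E1 E2.
have [s Hs] := realizes_ex p HT.
have : twist_fam 1 p = twist_fam (-1) p by rewrite !(@fam_realizes _ _ _ _ s _ HT Hs).
rewrite /twist_fam => /eqP; rewrite (eqr_div _ _ (lt0r_neq0 Hp) (lt0r_neq0 Hm)) !mul1r !mulN1r => /eqP E.
apply: (@mulfI _ 2); first by rewrite pnatr_eq0.
move: E; move: (V p) (V h) (V (prod_perm p h)) => x c y E.
have -> : 2 * y = (x + y) * (1 - c) - (x - y) * (1 + c) + 2 * (x * c) by ring.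
by rewrite E subrr add0r.
Qed.

End Multiplicativity.

Section Forward.

Variables (R : realType) (V : forall T : finType, {perm T} -> R[i]) (HV : charfam V).
Local Notation C := R[i].

(** An involution moves an even number of points, so each index from [i] on gets an extra bit to
    flip; this realises the fixed ratio [i / 2 ^ n] for all [i <= 2 ^ n]. *)
Definition fixed_block n i : {perm 'I_(2 ^ n) * {ffun unit -> bool}} :=
  skew 1 (ind [set x : 'I_(2 ^ n) | (i <= x)%N] (delta tt)).

Lemma fixed_block_invol n i : (fixed_block n i * fixed_block n i = 1)%g.
Proof. by apply: skew_invol; [rewrite mulg1 | move=> x; rewrite perm1]. Qed.

Lemma pow2_ord n : pow2 'I_(2 ^ n).
Proof. by exists n; rewrite card_ord. Qed.

Lemma card_fixed_block n : #|{: 'I_(2 ^ n) * {ffun unit -> bool}}| = (2 ^ n * 2)%N.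
Proof. by rewrite card_prod card_ord card_ffun card_bool card_unit. Qed.

Lemma nfix_fixed_block n i : (i <= 2 ^ n)%N -> nfix (fixed_block n i) = (i * 2)%N.
Proof.
move=> Hi; rewrite nfix_skew card_ffun card_bool card_unit; congr (_ * _)%N.
have winj : injective (widen_ord Hi) by move=> a b /(congr1 val) E; apply: val_inj.
rewrite -[RHS]card_ord -(card_imset _ winj); apply: eq_card => x.
rewrite !inE perm1 eqxx ind_eq0 ?delta_neq0 //= inE -ltnNge; apply/idP/imsetP => [xi|[y _ ->]].
  by exists (Ordinal xi) => //; apply: val_inj.
by rewrite /= ltn_ord.
Qed.

Let G n i : C := V (fixed_block n i).

Let G_fam n (T : finType) (p : {perm T}) i : pow2 T ->
  (nfix p * 2 ^ n = i * #|T|)%N -> V p = G n i.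
Proof.
move=> HT E; have Hi : (i <= 2 ^ n)%N.
  rewrite -(leq_pmul2r (pow2_gt0 HT)) -E mulnC leq_mul2l nfix_le orbT //.
apply: fam_nfix => //; first exact: pow2_K (pow2_ord n).
  exact: fixed_block_invol.
by rewrite card_fixed_block nfix_fixed_block // mulnA E mulnAC.
Qed.

Lemma indecomposable_power (chi : (X -> X) -> C) :
  (forall s, chi (s2act s) = V (sperm s)) -> is_indecomposable_character chi ->
  exists a, forall s, chi (s2act s) = (powinf (muFix s : R) a)%:C%C.
Proof.
move=> Hchi Hind; have HK n := pow2_K unit (pow2_ord n).
pose Gr n i := complex.Re (G n i).
have GE n i : G n i = (Gr n i)%:C%C.
  rewrite /Gr RRe_real // CrealE; apply/eqP; apply: fam_invol_real => //.
    exact: HK.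
  exact: fixed_block_invol.
have [||| a Ha] := @power_classification R Gr.
- move=> n j Hj; rewrite -ler0c.
  have := @alternating_sum_ge0 _ _ HV n j (2 ^ n - j) (subnKC Hj) (G n).
  rewrite (_ : \sum_(d < _) _ = (alt_sum (Gr n) j)%:C%C); first by apply=> *; apply: G_fam.
  rewrite /alt_sum rmorph_sum; apply: eq_bigr => d _.
  by rewrite GE !rmorphM rmorphXn rmorphN1 rmorph_nat.
- move=> n m i k Hi Hk; apply: complexI; rewrite rmorphM -[RHS]/((Gr n i)%:C%C * (Gr m k)%:C%C) -!GE.
  rewrite -(indecomposable_mul HV (HK m) (fixed_block_invol m k) _ Hchi Hind (HK n)).
  apply: esym; apply: G_fam; first exact: pow2_prod.
  rewrite nfix_prod !nfix_fixed_block // card_prod !card_fixed_block expnD; lia.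
- move=> n; apply: complexI; rewrite -GE rmorph1 -(@G_fam n unit 1%g) ?fam_one //; try exact: pow2_unit.
  by rewrite nfix1 card_unit mul1n muln1.
exists a => s; rewrite Hchi (@G_fam (lvl s) _ _ (nfix (sperm s))).
- rewrite GE Ha ?muFixE /fixratio ?card_tuple ?card_bool ?natrX //.
  by apply: leq_trans (nfix_le _) _; rewrite card_tuple card_bool.
- exact: pow2_tuple.
- by rewrite card_tuple card_bool.
Qed.

End Forward.

Local Open Scope complex_scope.

Theorem mainTheorem1 (R : realType) (chi : (X -> X) -> R[i]) :
  is_indecomposable_character chi <->
  exists alpha : option nat,
    forall s : S2elt, chi (s2act s) = (powinf (muFix s : R) alpha)%:C.
Proof.
split=> [Hind|[a Ha]]; last exact: powfam_indecomposable Ha.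
have [V HV Hchi] := fam_of_char_ex Hind.1.
exact (indecomposable_power HV Hchi Hind).
Qed.
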